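(* The base $U_q(\mathfrak{sp}(6))$-module $M$ for the quantum quaternionic projective plane (defined in the context) is irreducible.
   Context: $q$ is a nonzero complex number, not a root of unity; $\bar q=q^{-1}$, $[x,y]_a=xy-ayx$, $[x,y]=[x,y]_1$. Fix a logarithm of $q$. $\mathfrak{g}=\mathfrak{sp}(6)$ with Cartan subalgebra $\mathfrak{h}$; $\varepsilon_1,\varepsilon_2,\varepsilon_3$ is an orthonormal basis of $\mathfrak{h}^*$; simple roots $\alpha_1=\varepsilon_1-\varepsilon_2$, $\alpha_2=\varepsilon_2-\varepsilon_3$, $\alpha_3=2\varepsilon_3$. $U_q(\mathfrak{g})$ is the algebra generated by $e_i,f_i,q^{\pm h_i}$ ($i=1,2,3$), with the $q^{\pm h_i}$ commuting and invertible, $q^{h_i}e_j=q^{(\alpha_i,\alpha_j)}e_jq^{h_i}$, $q^{h_i}f_j=q^{-(\alpha_i,\alpha_j)}f_jq^{h_i}$, $[e_i,f_j]=\delta_{ij}\frac{q^{h_i}-q^{-h_i}}{q-q^{-1}}$, $[e_1,e_3]=0$, $[e_i,[e_i,e_j]_q]_{\bar q}=0$ for $\{i,j\}=\{1,2\}$, $[e_2,[e_2,[e_2,e_3]_{q^2}]]_{\bar q^2}=0$, $[e_3,[e_3,e_2]_{\bar q^2}]_{q^2}=0$, and the same relations with all $e$ replaced by $f$. A vector has weight $\mu\in\mathfrak{h}^*$ if $q^{h_i}$ acts on it by $q^{(\alpha_i,\mu)}$. Base weight: fix $\lambda\in\mathfrak{h}^*$ with $q^{(\lambda,\alpha_1)}=1=q^{(\lambda,\alpha_3)}$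 and $q^{2(\lambda,\varepsilon_1)}=q^{2(\lambda,\varepsilon_2)}=-q^{-2}$. Put $f_\delta=f_2^2f_3-(q^2+\bar q^2)f_2f_3f_2+f_3f_2^2$. The base module $M$ is the quotient of the Verma module of highest weight $\lambda$ and highest vector $1_\lambda$ by the submodule generated by $f_11_\lambda$, $f_31_\lambda$, $f_\delta1_\lambda$. *)

(* Defs.v *)
From HB Require Import structures.
From mathcomp Require Import all_boot all_order all_algebra.
From mathcomp Require Import complex monalg.
From mathcomp Require Import boolp classical_sets reals sequences exp trigo.

Set Implicit Arguments.
Unset Strict Implicit.
Unset Printing Implicit Defensive.

Import Order.TTheory GRing.Theory Num.Theory.
Import Quotient.

Local Open Scope ring_scope.
Local Open Scope quotient_scope.
Local Open Scope classical_set_scope.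

(* ring_quotient.v only equips quotients of commutative rings with a product. *)

Section RingQuotient.
Variable A : nzRingType.

Definition two_sided_ideal (I : set A) :=
  [/\ I 0, forall x y, I x -> I y -> I (x - y)
    & forall a b x, I x -> I (a * x * b)].

Definition ideal_gen (S : set A) : {pred A} :=
  fun x => `[< forall I, two_sided_ideal I -> S `<=` I -> I x >].

Variable S : set A.

Lemma ideal_gen_two_sided : two_sided_ideal [set` ideal_gen S].
Proof.
split=> [|x y /asboolP Ix /asboolP Iy|a b x /asboolP Ix]; apply/asboolP=> I II SI.
- by case: II.
- by case: (II) => _ IB _; apply: IB; [exact: Ix | exact: Iy].
- by case: (II) => _ _ IM; apply: IM; exact: Ix.
Qed.

Lemma ideal_gen_zmod_closed : zmod_closed (ideal_gen S).
Proof. by case: ideal_gen_two_sided => I0 IB _; split=> // x y; apply: IB. Qed.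

HB.instance Definition _ :=
  GRing.isZmodClosed.Build A (ideal_gen S) ideal_gen_zmod_closed.

Lemma mem_ideal_gen x : S x -> x \in ideal_gen S.
Proof. by move=> Sx; apply/asboolP => I _; apply. Qed.

Lemma ideal_genMl a x : x \in ideal_gen S -> a * x \in ideal_gen S.
Proof.
by case: ideal_gen_two_sided => _ _ IM Ix; rewrite -[a * x]mulr1; apply: IM.
Qed.

Lemma ideal_genMr b x : x \in ideal_gen S -> x * b \in ideal_gen S.
Proof.
by case: ideal_gen_two_sided => _ _ IM Ix; rewrite -[x]mul1r; apply: IM.
Qed.

Definition ringQuot : Type := {quot ideal_gen S}.
HB.instance Definition _ := ZmodQuotient.on ringQuot.

Lemma ringQuot_eq x y :
  (\pi_ringQuot x == \pi_ringQuot y) = (x - y \in ideal_gen S).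
Proof. by rewrite piE. Qed.

Definition rq_one : ringQuot := lift_cst ringQuot 1.
Definition rq_mul := lift_op2 ringQuot *%R.

Canonical pi_rq_one := PiConst rq_one.

Lemma pi_rq_mul : {morph \pi_ringQuot : x y / x * y >-> rq_mul x y}.
Proof.
move=> x y; unlock rq_mul; apply/eqP; rewrite ringQuot_eq.
set x' := repr _; set y' := repr _.
have Ix : x - x' \in ideal_gen S by rewrite -ringQuot_eq reprK.
have Iy : y - y' \in ideal_gen S by rewrite -ringQuot_eq reprK.
rewrite -(subrK (x' * y) (x * y)) -addrA -mulrBl -mulrBr.
by apply: rpredD; [exact: ideal_genMr | exact: ideal_genMl].
Qed.
Canonical pi_rq_mul_morph := PiMorph2 pi_rq_mul.

Lemma rq_mulA : associative rq_mul.
Proof. by move=> x y z; rewrite -[x]reprK -[y]reprK -[z]reprK !piE mulrA. Qed.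
Lemma rq_mul1 : left_id rq_one rq_mul.
Proof. by move=> x; rewrite -[x]reprK !piE mul1r. Qed.
Lemma rq_mulr1 : right_id rq_one rq_mul.
Proof. by move=> x; rewrite -[x]reprK !piE mulr1. Qed.
Lemma rq_mulDl : left_distributive rq_mul +%R.
Proof.
by move=> x y z; rewrite -[x]reprK -[y]reprK -[z]reprK !piE mulrDl.
Qed.
Lemma rq_mulDr : right_distributive rq_mul +%R.
Proof.
by move=> x y z; rewrite -[x]reprK -[y]reprK -[z]reprK !piE mulrDr.
Qed.

HB.instance Definition _ := GRing.Zmodule_isPzRing.Build ringQuot
  rq_mulA rq_mul1 rq_mulr1 rq_mulDl rq_mulDr.

Lemma pi_ringQuot1 : \pi_ringQuot 1 = 1.
Proof. by rewrite piE. Qed.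

Lemma pi_ringQuotM : {morph \pi_ringQuot : x y / x * y}.
Proof. exact: pi_rq_mul. Qed.

End RingQuotient.

Section LmodQuotient.
Variables (A : pzRingType) (V : lmodType A).

Definition lmod_span (S : set V) : {pred V} :=
  fun v => `[< forall W : submodClosed V, S `<=` [set` W] -> v \in W >].

Variable S : set V.

Lemma lmod_span_submod_closed : submod_closed (lmod_span S).
Proof.
split=> [|a u v /asboolP Iu /asboolP Iv]; apply/asboolP=> W SW.
  exact: rpred0.
by rewrite rpredD ?rpredZ ?Iu ?Iv.
Qed.

HB.instance Definition _ :=
  GRing.isSubmodClosed.Build A V (lmod_span S) lmod_span_submod_closed.

Definition lmodQuot : Type := {quot lmod_span S}.
HB.instance Definition _ := ZmodQuotient.on lmodQuot.

Lemma lmodQuot_eq x y :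
  (\pi_lmodQuot x == \pi_lmodQuot y) = (x - y \in lmod_span S).
Proof. by rewrite piE. Qed.

Definition lq_scale a := lift_op1 lmodQuot ( *:%R a).

Lemma pi_lq_scale a : {morph \pi_lmodQuot : x / a *: x >-> lq_scale a x}.
Proof.
move=> x; unlock lq_scale; apply/eqP; rewrite lmodQuot_eq -scalerBr rpredZ //.
by rewrite -lmodQuot_eq reprK.
Qed.
Canonical pi_lq_scale_morph a := PiMorph1 (pi_lq_scale a).

Lemma lq_scaleA a b v : lq_scale a (lq_scale b v) = lq_scale (a * b) v.
Proof. by rewrite -[v]reprK !piE scalerA. Qed.
Lemma lq_scale1 : left_id 1 lq_scale.
Proof. by move=> v; rewrite -[v]reprK !piE scale1r. Qed.
Lemma lq_scaleDr : right_distributive lq_scale +%R.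
Proof. by move=> a u v; rewrite -[u]reprK -[v]reprK !piE scalerDr. Qed.
Lemma lq_scaleDl v : {morph lq_scale^~ v : a b / a + b}.
Proof. by move=> a b /=; rewrite -[v]reprK !piE scalerDl. Qed.

HB.instance Definition _ := GRing.Zmodule_isLmodule.Build A lmodQuot
  lq_scaleA lq_scale1 lq_scaleDr lq_scaleDl.

Lemma pi_lmodQuotZ a : {morph \pi_lmodQuot : v / a *: v}.
Proof. exact: pi_lq_scale. Qed.

End LmodQuotient.

Definition irreducible_lmod (A : pzRingType) (V : lmodType A) :=
  (exists v : V, v != 0) /\
  forall W : submodClosed V,
    (forall v, v \in W -> v = 0) \/ (forall v, v \in W).

Section ComplexPower.
Variable R : realType.

Definition cexp (z : R[i]) : R[i] :=
  Complex (expR (complex.Re z) * cos (complex.Im z))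
          (expR (complex.Re z) * sin (complex.Im z)).

(* q^z with respect to the logarithm hbar of q *)
Definition qpow (hbar z : R[i]) : R[i] := cexp (hbar * z).

End ComplexPower.

(* The indices 1, 2, 3 of the simple roots of sp(6) are shifted to 0, 1, 2. *)
Definition i1 : 'I_3 := @Ordinal 3 0 isT.
Definition i2 : 'I_3 := @Ordinal 3 1 isT.
Definition i3 : 'I_3 := @Ordinal 3 2 isT.

Section Weights.
Variable Z : comNzRingType.

(* Elements of h^* are given by their coordinates in the orthonormal basis
   eps i1, eps i2, eps i3; the form is bilinear (not sesquilinear).  The simple
   roots are used both over int, for the exponents in the relations, and over
   the complex numbers. *)
Definition eps (i : 'I_3) : 'rV[Z]_3 := delta_mx 0 i.

Definition bform (u v : 'rV[Z]_3) : Z := \sum_i u 0 i * v 0 i.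

Definition alpha (i : 'I_3) : 'rV[Z]_3 :=
  if i == i1 then eps i1 - eps i2
  else if i == i2 then eps i2 - eps i3
  else eps i3 *+ 2.

End Weights.

(* Generators e_i, f_i and q^{h_i} = GenK false i, q^{-h_i} = GenK true i. *)
Inductive generator := GenE of 'I_3 | GenF of 'I_3 | GenK of bool & 'I_3.

Definition generator_code (g : generator) : 'I_3 + 'I_3 + bool * 'I_3 :=
  match g with
  | GenE i => inl (inl i) | GenF i => inl (inr i) | GenK b i => inr (b, i)
  end.

Definition generator_decode (c : 'I_3 + 'I_3 + bool * 'I_3) : generator :=
  match c with
  | inl (inl i) => GenE i | inl (inr i) => GenF i | inr (b, i) => GenK b i
  end.

Lemma generator_codeK : cancel generator_code generator_decode.
Proof. by case. Qed.

HB.instance Definition _ := Countable.copy generator (can_type generator_codeK).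

Section QuantumGroup.
Variables (R : realType) (q : R[i]).

Local Notation freeAlg := {malg R[i][{fmonom generator}]}.

Definition gen (g : generator) : freeAlg := mkmalgU (fmu g) 1.

Local Notation e i := (gen (GenE i)).
Local Notation f i := (gen (GenF i)).
Local Notation qh i := (gen (GenK false i)).
Local Notation qhV i := (gen (GenK true i)).

(* [x, y]_a *)
Definition qbr (a : R[i]) (x y : freeAlg) : freeAlg := x * y - a *: (y * x).

Definition serre (x : 'I_3 -> freeAlg) : seq freeAlg :=
  [:: qbr 1 (x i1) (x i3);
      qbr q^-1 (x i1) (qbr q (x i1) (x i2));
      qbr q^-1 (x i2) (qbr q (x i2) (x i1));
      qbr (q ^- 2) (x i2) (qbr 1 (x i2) (qbr (q ^+ 2) (x i2) (x i3)));
      qbr (q ^+ 2) (x i3) (qbr (q ^- 2) (x i3) (x i2))].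

Definition root_form (i j : 'I_3) : int := bform (alpha int i) (alpha int j).

(* Differences of the two sides of the defining relations of U_q(sp(6)). *)
Inductive Uq_relator : freeAlg -> Prop :=
| Rel_qhC b i b' j :
    Uq_relator
      (gen (GenK b i) * gen (GenK b' j) - gen (GenK b' j) * gen (GenK b i))
| Rel_qhV b i : Uq_relator (gen (GenK b i) * gen (GenK (~~ b) i) - 1)
| Rel_qh_e i j :
    Uq_relator (qh i * e j - q ^ root_form i j *: (e j * qh i))
| Rel_qh_f i j :
    Uq_relator (qh i * f j - q ^ (- root_form i j) *: (f j * qh i))
| Rel_e_f i j :
    Uq_relator (qbr 1 (e i) (f j) -
      (i == j)%:R *: ((q - q^-1)^-1 *: (qh i - qhV i)))
| Rel_serre_e r : r \in serre (fun i => e i) -> Uq_relator r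
| Rel_serre_f r : r \in serre (fun i => f i) -> Uq_relator r.

(* Only the ring structure is recorded: a complex scalar c is the class of
   c%:A, hence U_q-submodules are automatically complex subspaces. *)
Definition Uq : pzRingType := ringQuot Uq_relator.

Definition Uq_of (x : freeAlg) : Uq := \pi_(ringQuot Uq_relator) x.

Definition f_delta : freeAlg :=
  f i2 ^+ 2 * f i3 - (q ^+ 2 + q ^- 2) *: (f i2 * f i3 * f i2)
  + f i3 * f i2 ^+ 2.

Section BaseModule.
(* hbar is the logarithm of q defining the complex powers of q *)
Variables (hbar : R[i]) (lambda : 'rV[R[i]]_3).

(* Verma module: U_q modulo the left ideal generated by the e_i and the
   q^{h_i} - q^{(alpha_i, lambda)}; its highest vector is the class of 1. *)
Definition Verma_relators : set (Uq^o : lmodType Uq) :=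
  [set x | exists i, x = Uq_of (e i) \/
     x = Uq_of (qh i - (qpow hbar (bform (alpha _ i) lambda))%:A)].

Definition Verma : lmodType Uq := lmodQuot Verma_relators.

Definition Verma_hv : Verma := \pi_(lmodQuot Verma_relators) (1 : Uq^o).

Definition base_relators : set Verma :=
  [set Uq_of x *: Verma_hv | x in [set f i1; f i3; f_delta]].

Definition base_module : lmodType Uq := lmodQuot base_relators.

End BaseModule.

End QuantumGroup.

(* Main.v *)
(**
  Call a vector w good if f1, f3, f_delta, e1 and e3 kill it
  and q^h1, q^h3 fix it. Put t = q + q^-1, c = q^2 + q^-2 and
    g w = f2 f1 f3 f2 w - (t c)^-1 f1 f3 f2^2 w.
  The Serre relations make f2 f1 f2^m w and f2 f3 f2^m w proportional to
  f1 f2^(m+1) w and f3 f2^(m+1) w, and put f2 f1 f3 f2^m w in the span of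
  f1 f3 f2^(m+1) w and f2^(m-1) g w. Since f_delta commutes with f2 and f3 and
  f_delta f1 f2 w = (2 - c) f2 g w, evaluating f_delta g w in two ways shows
  that it vanishes; hence g w is good again, and M is spanned by the vectors
    f1^i f3^j f2^m g^k 1   with i, j <= m.
  The operator e2^(m+k) (e3 e1 e2)^k e3^j e1^i kills the lexicographically
  smaller vectors, in the order of (i, j, k, m), and sends this one to a nonzero multiple of 1.
  So every nonzero submodule contains 1. What makes the multiple nonzero is
    e2 g^(k+1) 1 = [k+1] kappa q / (q - q^-1) f1 f3 f2 g^k 1,
  where q^h2 1 = kappa 1 and kappa^2 = - q^-2.

  That 1 is nonzero in M is seen on the functions on words in the e's, where e_i
  prepends a letter and the f's act as the commutation relations force them to.
  There the f-Serre elements commute with the e's and vanish on the empty word,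
  hence act by zero; dually, the e-Serre elements commute with the f's and so
  vanish on the submodule generated by the delta function at the empty word.
*)

Require Import Defs.
From mathcomp Require Import all_boot all_order all_algebra.
From mathcomp Require Import complex monalg.
From mathcomp Require Import boolp classical_sets reals sequences exp trigo.
From HB Require Import structures.
From mathcomp Require Import finmap functions ring.

Set Implicit Arguments.
Unset Strict Implicit.
Unset Printing Implicit Defensive.

Import Order.TTheory GRing.Theory Num.Theory.
Import Quotient.

Local Open Scope ring_scope.
Local Open Scope quotient_scope.

(** * Linear combinations *)

Section LinearCombinations.
Variables (K : fieldType) (V : lmodType K).

Inductive lincomb :=
  LAtom of nat | LZero | LAdd of lincomb & lincomb | LOpp of lincomb
| LScale of K & lincomb.

Fixpoint leval (env : seq V) (x : lincomb) : V :=
  match x with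
  | LAtom n => env`_n
  | LZero => 0
  | LAdd x y => leval env x + leval env y
  | LOpp x => - leval env x
  | LScale a x => a *: leval env x
  end.

(** [eqn] instead of [==] lets [cbn] decide whether two atoms agree. *)
Fixpoint lcoef (x : lincomb) (n : nat) : K :=
  match x with
  | LAtom m => if eqn n m then 1 else 0
  | LZero => 0
  | LAdd x y => lcoef x n + lcoef y n
  | LOpp x => - lcoef x n
  | LScale a x => a * lcoef x n
  end.

(** A nested conjunction rather than a quantified statement, so that [cbn] and [split] leave one
    scalar identity per atom. *)
Definition lcoefs_eq (x y : lincomb) (s : seq nat) : Prop :=
  foldr (fun n P => lcoef x n = lcoef y n /\ P) True s.

Lemma levalE env x : leval env x = \sum_(n < size env) lcoef x n *: env`_n.
Proof.
elim: x => /= [m||x -> y ->|x ->|a x ->].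
- have [lt_m|ge_m] := ltnP m (size env); last first.
    rewrite nth_default // big1 // => n _.
    have /negPf -> : ~~ eqn n m.
      by rewrite -[eqn _ _]/(_ == _) ltn_eqF // (leq_trans (ltn_ord n)).
    by rewrite scale0r.
  rewrite (bigD1 (Ordinal lt_m)) //= -[eqn m m]/(m == m) eqxx scale1r big1 ?addr0 // => n.
  by rewrite -val_eqE /= -[eqn _ _]/(_ == _) => /negPf ->; rewrite scale0r.
- by rewrite big1 // => n _; rewrite scale0r.
- by rewrite -big_split /=; apply: eq_bigr => n _; rewrite scalerDl.
- by rewrite -sumrN; apply: eq_bigr => n _; rewrite scaleNr.
- by rewrite scaler_sumr; apply: eq_bigr => n _; rewrite scalerA.
Qed.

Lemma leval_eq env x y :
  lcoefs_eq x y (iota 0 (size env)) -> leval env x = leval env y.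
Proof.
move=> eq_xy; rewrite !levalE; apply: eq_bigr => n _; congr (_ *: _).
have: val n \in iota 0 (size env) by rewrite mem_iota /= add0n.
elim: (iota _ _) eq_xy => //= m s IHs [eq_m /IHs eq_s].
by rewrite inE => /orP[/eqP -> //|].
Qed.

End LinearCombinations.

(* Atoms are compared up to conversion: rewriting with linearity leaves
   convertible but syntactically distinct structure instances. *)
Ltac lin_index v env :=
  match env with
  | ?x :: _ => let _ := match goal with _ => unify x v end in constr:(0%N)
  | _ :: ?env' => let n := lin_index v env' in constr:(S n)
  end.

Ltac lin_atoms v env :=
  lazymatch v with
  | ?x + ?y => let env := lin_atoms x env in lin_atoms y env
  | - ?x => lin_atoms x env
  | _ *: ?x => lin_atoms x env
  | 0 => env
  | _ => match goal with
         | _ => let _ := lin_index v env in env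
         | _ => constr:(v :: env)
         end
  end.

Ltac lin_quote K v env :=
  lazymatch v with
  | ?x + ?y =>
      let x := lin_quote K x env in
      let y := lin_quote K y env in constr:(LAdd x y)
  | - ?x => let x := lin_quote K x env in constr:(LOpp x)
  | ?a *: ?x => let x := lin_quote K x env in constr:(LScale a x)
  | 0 => constr:(LZero K)
  | _ => let n := lin_index v env in constr:(LAtom K n)
  end.

(* Reduces an equality of linear combinations to the equality of the
   coefficients of each atom. *)
Ltac lin K :=
  match goal with |- @eq ?T ?x ?y =>
    let env := lin_atoms x (@nil T) in
    let env := lin_atoms y env in
    let x' := lin_quote K x env in
    let y' := lin_quote K y env in
    apply: (@leval_eq K _ env x' y');
    cbn [lcoefs_eq foldr iota size lcoef eqn]; repeat split
  end.

(** * Quantum integers *)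

(** Locked, so that [field] treats [n] as an atom; many computations use only the recurrence
    [qnum_rec]. *)
HB.lock Definition qnum (K : fieldType) (q : K) (n : nat) : K :=
  (q ^+ n - q ^- n) / (q - q^-1).

Section QuantumNumbers.
Variables (K : fieldType) (q : K).
Hypotheses (q_neq0 : q != 0) (q_nroot : forall n, (0 < n)%N -> q ^+ n != 1).

Lemma qsubV_neq0 : q - q^-1 != 0.
Proof.
rewrite subr_eq0; apply/eqP => /(congr1 ( *%R q)).
by rewrite divff // -expr2; apply/eqP/q_nroot.
Qed.

Lemma qnum0 : qnum q 0 = 0.
Proof. by rewrite qnum.unlock expr0 invr1 subrr mul0r. Qed.

Lemma qnum1 : qnum q 1 = 1.
Proof. by rewrite qnum.unlock expr1 divff ?qsubV_neq0. Qed.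

Lemma qnum_rec n : qnum q n.+2 = (q + q^-1) * qnum q n.+1 - qnum q n.
Proof.
have qn0 : q ^+ n != 0 by rewrite expf_neq0.
have q21 : q * q - 1 != 0 by rewrite -expr2 subr_eq0 q_nroot.
by rewrite qnum.unlock !exprSr; field; rewrite q_neq0 q21 qn0.
Qed.

(** A zero would give q^(2n+2) = 1. *)
Lemma qnum_neq0 n : qnum q n.+1 != 0.
Proof.
rewrite qnum.unlock mulf_neq0 ?invr_neq0 ?qsubV_neq0 // subr_eq0.
apply/eqP => /(congr1 ( *%R (q ^+ n.+1))).
by rewrite divff ?expf_neq0 // -exprD; apply/eqP/q_nroot; rewrite addSn.
Qed.

End QuantumNumbers.

(** * Actions of the generators *)

Section Operators.
Variables (K : fieldType) (q : K) (V : lmodType K).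

(** The Gram matrix of the simple roots, that is the symmetrised Cartan matrix; [root_formE]
    identifies it with [root_form]. *)
Definition cartan (i j : 'I_3) : int :=
  nth 0 (nth [::] [:: [:: 2%:Z; -1; 0]; [:: -1; 2%:Z; - 2%:Z]; [:: 0; - 2%:Z; 4%:Z]] i) j.

(* The Serre relations are imposed separately, through serre_ops. *)
Record pre_action := PreAction {
  opE : 'I_3 -> {linear V -> V};
  opF : 'I_3 -> {linear V -> V};
  opK : 'I_3 -> {linear V -> V};
  opKV : 'I_3 -> {linear V -> V};
  opKK : forall i v, opK i (opKV i v) = v;
  opKVK : forall i v, opKV i (opK i v) = v;
  opKE : forall i j v, opK i (opE j v) = q ^ cartan i j *: opE j (opK i v);
  opKF : forall i j v, opK i (opF j v) = q ^ (- cartan i j) *: opF j (opK i v);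
  opEF : forall i j v, opE i (opF j v) = opF j (opE i v) +
    (i == j)%:R *: ((q - q^-1)^-1 *: (opK i v - opKV i v)) }.

(** The five elements of [serre], in the same order and with the q-commutators multiplied out;
    [serre_commutators] checks the agreement. *)
Definition serre_ops (x : 'I_3 -> V -> V) (v : V) : seq V :=
  let t := q + q^-1 in let c := q ^+ 2 + q ^- 2 in
  [:: x i1 (x i3 v) - x i3 (x i1 v);
      x i1 (x i1 (x i2 v)) - t *: x i1 (x i2 (x i1 v)) + x i2 (x i1 (x i1 v));
      x i2 (x i2 (x i1 v)) - t *: x i2 (x i1 (x i2 v)) + x i1 (x i2 (x i2 v));
      x i2 (x i2 (x i2 (x i3 v))) - (1 + c) *: x i2 (x i2 (x i3 (x i2 v))) +
        (1 + c) *: x i2 (x i3 (x i2 (x i2 v))) - x i3 (x i2 (x i2 (x i2 v)));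
      x i3 (x i3 (x i2 v)) - c *: x i3 (x i2 (x i3 v)) + x i2 (x i3 (x i3 v))].

Definition fdelta (x : 'I_3 -> V -> V) (v : V) : V :=
  x i2 (x i2 (x i3 v)) - (q ^+ 2 + q ^- 2) *: x i2 (x i3 (x i2 v)) + x i3 (x i2 (x i2 v)).

End Operators.

Lemma ord3P (i : 'I_3) : [\/ i = i1, i = i2 | i = i3].
Proof.
case: i => -[|[|[|]]] // ?; [apply: Or31|apply: Or32|apply: Or33]; exact: val_inj.
Qed.

Lemma seq_has_max (d : Order.disp_t) (T : orderType d) (x : T) (s : seq T) :
  exists2 y, y \in x :: s & forall z, z \in x :: s -> (z <= y)%O.
Proof.
elim: s x => [|y s IHs] x.
  by exists x; rewrite ?mem_head // => z; rewrite inE => /eqP ->.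
have [m s_m max_m] := IHs y; have [le_xm|lt_mx] := leP x m.
  exists m; first by rewrite inE s_m orbT.
  by move=> z; rewrite inE => /orP[/eqP -> //|/max_m].
exists x; first exact: mem_head.
move=> z; rewrite inE => /orP[/eqP -> //|/max_m le_zm].
exact: le_trans le_zm (ltW lt_mx).
Qed.

Lemma qcartan (K : fieldType) (q : K) :
  (q ^ cartan i1 i1 = q ^+ 2) * (q ^ (- cartan i1 i1) = q ^- 2) *
  (q ^ cartan i1 i2 = q^-1) * (q ^ (- cartan i1 i2) = q) *
  (q ^ cartan i1 i3 = 1) * (q ^ (- cartan i1 i3) = 1) *
  (q ^ cartan i2 i1 = q^-1) * (q ^ (- cartan i2 i1) = q) *
  (q ^ cartan i2 i2 = q ^+ 2) * (q ^ (- cartan i2 i2) = q ^- 2) *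
  (q ^ cartan i2 i3 = q ^- 2) * (q ^ (- cartan i2 i3) = q ^+ 2) *
  (q ^ cartan i3 i1 = 1) * (q ^ (- cartan i3 i1) = 1) *
  (q ^ cartan i3 i2 = q ^- 2) * (q ^ (- cartan i3 i2) = q ^+ 2) *
  (q ^ cartan i3 i3 = q ^+ 4) * (q ^ (- cartan i3 i3) = q ^- 4).
Proof. by do !split. Qed.

Section PreAction.
Variables (K : fieldType) (q : K) (V : lmodType K) (A : pre_action q V).
Hypothesis q_neq0 : q != 0.

Lemma opKVE i j v : opKV A i (opE A j v) = q ^ (- cartan i j) *: opE A j (opKV A i v).
Proof.
have qc0 : q ^ cartan i j != 0 by rewrite expfz_eq0 negb_and q_neq0 orbT.
apply: (scalerI qc0); rewrite scalerA -expfzDr // subrr expr0z scale1r.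
by rewrite -[in RHS](opKVK A i (opE A j _)) opKE opKK linearZ.
Qed.

Lemma opKVF i j v : opKV A i (opF A j v) = q ^ cartan i j *: opF A j (opKV A i v).
Proof.
have qc0 : q ^ (- cartan i j) != 0 by rewrite expfz_eq0 negb_and q_neq0 orbT.
apply: (scalerI qc0); rewrite scalerA -expfzDr // addNr expr0z scale1r.
by rewrite -[in RHS](opKVK A i (opF A j _)) opKF opKK linearZ.
Qed.

(** The Chevalley involution: e and f are exchanged and each q^(h_i) is inverted. It transfers
    statements on the e-Serre elements to the f-Serre elements. *)
Definition dual_action : pre_action q V.
Proof.
refine (@PreAction _ q V (opF A) (opE A) (opKV A) (opK A) (opKVK A) (opKK A) opKVF opKVE _).
move=> i j v; rewrite opEF eq_sym; case: eqVneq => [->|_].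
  by lin K; ring.
by rewrite !scale0r !addr0.
Defined.

Lemma opEF_eq_vec i v : opE A i (opF A i v) =
  opF A i (opE A i v) + ((q - q^-1)^-1 *: opK A i v - (q - q^-1)^-1 *: opKV A i v).
Proof. by rewrite opEF eqxx scale1r scalerBr. Qed.

Lemma opEF_neq i j v : i != j -> opE A i (opF A j v) = opF A j (opE A i v).
Proof. by move=> /negPf ij; rewrite opEF ij scale0r addr0. Qed.

Hypothesis q_nroot : forall n, (0 < n)%N -> q ^+ n != 1.

(** Moving f_j to the left through a Serre element leaves terms in which f_j has been replaced by
    q^(h_j) or its inverse. Once these are moved to the left as well, their coefficients cancel. *)
Lemma serre_opE_opF j v :
  serre_ops q (opE A) (opF A j v) = [seq opF A j y | y <- serre_ops q (opE A) v].
Proof.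
have q21 : q * q - 1 != 0 by rewrite -expr2 subr_eq0 q_nroot.
have opE_K i l x : opE A l (opK A i x) = q ^ (- cartan i l) *: opK A i (opE A l x).
  by rewrite opKE scalerA -expfzDr // addNr expr0z scale1r.
have opE_KV i l x : opE A l (opKV A i x) = q ^ (cartan i l) *: opKV A i (opE A l x).
  by rewrite opKVE scalerA -expfzDr // subrr expr0z scale1r.
have neqs := (fun x => @opEF_neq i1 i2 x isT, fun x => @opEF_neq i1 i3 x isT,
  fun x => @opEF_neq i2 i1 x isT, fun x => @opEF_neq i2 i3 x isT,
  fun x => @opEF_neq i3 i1 x isT, fun x => @opEF_neq i3 i2 x isT).
have opED i x y : opE A i (x + y) = opE A i x + opE A i y by rewrite linearD.
have opEN i x : opE A i (- x) = - opE A i x by rewrite linearN.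
have opEZ i a x : opE A i (a *: x) = a *: opE A i x by rewrite linearZ.
have opFD i x y : opF A i (x + y) = opF A i x + opF A i y by rewrite linearD.
have opFN i x : opF A i (- x) = - opF A i x by rewrite linearN.
have opFZ i a x : opF A i (a *: x) = a *: opF A i x by rewrite linearZ.
have [->|->|->] := ord3P j.
all: rewrite /serre_ops /=; congr [:: _; _; _; _; _].
all: rewrite !(neqs, opEF_eq_vec, opED, opEN, opEZ, opFD, opFN, opFZ, opE_K, opE_KV) ?qcartan.
all: move: (opE A i1) (opE A i2) (opE A i3) => E1 E2 E3.
all: by lin K; field; rewrite ?q_neq0 ?q21.
Qed.

End PreAction.

(** * Spanning vectors of a highest weight module *)

Section HighestWeight.
Variables (K : fieldType) (q : K) (V : lmodType K) (A : pre_action q V).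
Hypotheses (q_neq0 : q != 0) (q_nroot : forall n, (0 < n)%N -> q ^+ n != 1).
Hypothesis two_neq0 : 2 != 0 :> K.
Hypothesis serreF : forall v, serre_ops q (opF A) v = nseq 5 0.

Local Notation e1 := (opE A i1).
Local Notation e2 := (opE A i2).
Local Notation e3 := (opE A i3).
Local Notation f1 := (opF A i1).
Local Notation f2 := (opF A i2).
Local Notation f3 := (opF A i3).
Local Notation k1 := (opK A i1).
Local Notation k2 := (opK A i2).
Local Notation k3 := (opK A i3).
Local Notation t := (q + q^-1).
Local Notation c := (q ^+ 2 + q ^- 2).

(** Since (alpha_3, alpha_3) = 4, the quantum integers attached to alpha_3 are taken in q^2; this
    makes the lemmas on [qnum] available for them. *)
Lemma q2_nroot n : (0 < n)%N -> (q ^+ 2) ^+ n != 1.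
Proof. by move=> n_gt0; rewrite -exprM q_nroot // muln_gt0. Qed.
Lemma q2_neq0 : q ^+ 2 != 0. Proof. by rewrite expf_neq0. Qed.

Local Notation rho1 m := (qnum q m / qnum q m.+1).
Local Notation rho3 m := (qnum (q ^+ 2) m / qnum (q ^+ 2) m.+1).
Local Notation qn := (qnum q).
Local Notation qm := (qnum (q ^+ 2)).

Lemma qn1 : qn 1 = 1. Proof. exact: qnum1. Qed.
Lemma qm1 : qm 1 = 1. Proof. exact: (qnum1 q2_neq0 q2_nroot). Qed.
Lemma qnS m : qn m.+2 = t * qn m.+1 - qn m. Proof. exact: qnum_rec. Qed.
Lemma qmS m : qm m.+2 = c * qm m.+1 - qm m. Proof. exact: (qnum_rec q2_neq0 q2_nroot). Qed.
Lemma qnN0 m : qn m.+1 != 0. Proof. exact: qnum_neq0. Qed.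
Lemma qmN0 m : qm m.+1 != 0. Proof. exact: (qnum_neq0 q2_neq0 q2_nroot). Qed.
Lemma t_neq0 : t != 0. Proof. by move: (qnN0 1); rewrite qnS qn1 qnum0 subr0 mulr1. Qed.
Lemma c_neq0 : c != 0. Proof. by move: (qmN0 1); rewrite qmS qm1 qnum0 subr0 mulr1. Qed.
(** 1 + c is the quantum integer [3]. *)
Lemma c1_neq0 : 1 + c != 0.
Proof.
move: (qnN0 2); rewrite !qnS qn1 qnum0 subr0 mulr1.
by congr (_ != 0); field.
Qed.

(** This is t [m+1] - [m] = [m+2] divided by t [m+1]. The left-hand side is the denominator met when
    [f21_pow] solves its recursion. *)
Lemma s_step m : 1 - t^-1 * rho1 m = t^-1 * (qn m.+2 / qn m.+1).
Proof.
rewrite qnS; move: t_neq0 (qnN0 m).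
by move: t (qn m.+1) (qn m) => T x y T0 x0; field; rewrite T0 x0.
Qed.

Lemma s_step_neq0 m : 1 - t^-1 * rho1 m != 0.
Proof. by rewrite s_step !mulf_eq0 !invr_eq0 !negb_or t_neq0 !qnN0. Qed.

Lemma s_stepV m : t^-1 = rho1 m.+1 * (1 - t^-1 * rho1 m).
Proof.
rewrite s_step mulrCA; move: (qnN0 m) (qnN0 m.+1).
by move: (qn m.+1) (qn m.+2) => x y x0 y0; rewrite -[LHS]mulr1; congr (_ * _); field; rewrite x0 y0.
Qed.

Lemma r_step_neq0 m : 1 - c^-1 * rho3 m != 0.
Proof.
rewrite (_ : _ - _ = c^-1 * (qm m.+2 / qm m.+1)).
  by rewrite !mulf_eq0 !invr_eq0 !negb_or c_neq0 !qmN0.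
rewrite qmS; move: c_neq0 (qmN0 m).
by move: c (qm m.+1) (qm m) => T x y T0 x0; field; rewrite T0 x0.
Qed.

Lemma r_stepV m : c^-1 = rho3 m.+1 * (1 - c^-1 * rho3 m).
Proof.
move: (qmN0 m) (qmN0 m.+1); rewrite qmS; move: c_neq0.
by move: c (qm m.+1) (qm m) => T x y T0 x0 y0; field; rewrite T0 x0.
Qed.

(** * The Serre relations as rewriting rules, and the commutation of f_delta with f2 and f3 *)

Lemma f13 v : f1 (f3 v) = f3 (f1 v).
Proof. by have [/eqP + _ _ _ _] := serreF v; rewrite subr_eq0 => /eqP. Qed.

Lemma f112 v : f1 (f1 (f2 v)) = t *: f1 (f2 (f1 v)) - f2 (f1 (f1 v)).
Proof.
have [_ /eqP + _ _ _] := serreF v; rewrite addr_eq0 => /eqP <-.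
by rewrite addrC subrK.
Qed.

Lemma f221 v : f2 (f1 (f2 v)) = t^-1 *: (f2 (f2 (f1 v)) + f1 (f2 (f2 v))).
Proof.
have [_ _ + _ _] := serreF v; rewrite addrAC => /eqP; rewrite subr_eq0 => /eqP ->.
by rewrite scalerA mulVf ?scale1r ?t_neq0.
Qed.

Lemma f2223 v : f3 (f2 (f2 (f2 v))) = f2 (f2 (f2 (f3 v)))
  - (1 + c) *: f2 (f2 (f3 (f2 v))) + (1 + c) *: f2 (f3 (f2 (f2 v))).
Proof. by have [_ _ _ /eqP + _] := serreF v; rewrite subr_eq0 => /eqP <-. Qed.

Lemma f332 v : f3 (f3 (f2 v)) = c *: f3 (f2 (f3 v)) - f2 (f3 (f3 v)).
Proof.
have [_ _ _ _ /eqP] := serreF v; rewrite addr_eq0 => /eqP <-.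
by rewrite addrC subrK.
Qed.

Local Notation D := (fdelta q (opF A)).

(** The commutator of f2 and f_delta is the Serre element of degree three in f2. *)
Lemma fdelta_f2 v : D (f2 v) = f2 (D v).
Proof.
rewrite /fdelta !(linearD, linearZ, linearN) /= f2223. lin K; ring.
Qed.

(** If S is the Serre element of degree two in f3, then f3 f_delta - f_delta f3 = S f2 - f2 S. *)
Lemma fdelta_f3 v : D (f3 v) = f3 (D v).
Proof.
rewrite /fdelta !(linearD, linearZ, linearN) /= !f332.
rewrite !(linearD, linearZ, linearN) /=; lin K; ring.
Qed.

Lemma fdeltaZ a v : D (a *: v) = a *: D v.
Proof. by rewrite /fdelta !linearZ /=; lin K; ring. Qed.

Lemma fdeltaB u v : D (u - v) = D u - D v.
Proof. by rewrite /fdelta !linearB /=; lin K; ring. Qed.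

Lemma opKF_weight i j v a : opK A i v = a *: v ->
  opK A i (opF A j v) = (q ^ (- cartan i j) * a) *: opF A j v.
Proof. by move=> kv; rewrite opKF kv linearZ scalerA. Qed.

Lemma opEF_eq i v a : a != 0 -> opK A i v = a *: v ->
  opE A i (opF A i v) = opF A i (opE A i v) + ((a - a^-1) / (q - q^-1)) *: v.
Proof.
move=> a0 kv; rewrite opEF eqxx scale1r kv.
have -> : opKV A i v = a^-1 *: v.
  by rewrite -[in RHS](opKVK A i v) kv linearZ scalerA mulVf // scale1r.
by rewrite -scalerBl scalerA [_ * (a - _)]mulrC.
Qed.

(* The properties of the highest vector that ginv preserves. *)
Record good (w : V) : Prop := Good {
  good_f1 : f1 w = 0; good_f3 : f3 w = 0; good_fdelta : D w = 0;
  good_e1 : e1 w = 0; good_e3 : e3 w = 0;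
  good_k1 : k1 w = w; good_k3 : k3 w = w }.

(** Rewriting with the Serre relations returns the vector sought with some coefficient [a]; this
    isolates it. *)
Lemma solve_lin (x y : V) (a b d : K) :
  x = a *: x + b *: y -> 1 - a != 0 -> b = d * (1 - a) -> x = d *: y.
Proof.
move=> eq_x na eq_b; apply: (scalerI na).
by rewrite scalerBl scale1r {1}eq_x addrAC subrr add0r eq_b scalerA mulrC.
Qed.

Definition fpow (g : {linear V -> V}) n v := iter n g v.
Arguments fpow : simpl never.
Local Notation "g ^^ n" := (fpow g n) (at level 30).

Lemma fpow0 g v : (g ^^ 0) v = v. Proof. by []. Qed.
Lemma fpowS g n v : (g ^^ n.+1) v = g ((g ^^ n) v). Proof. by []. Qed.

(** * Good vectors and the operator g *)

Section Good.
Variable (w : V).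
Hypothesis w_good : good w.
Local Notation "m .-th" := ((f2 ^^ m) w) (at level 2, format "m .-th").

Lemma fdelta_pow m : D m.-th = 0.
Proof.
elim: m => [|m IHm]; first exact: good_fdelta.
by rewrite fpowS fdelta_f2 IHm linear0.
Qed.

(** By the induction hypothesis, [f221] at f2^m w expresses f2 f1 f2^(m+1) w through itself and f1
    f2^(m+2) w. *)
Lemma f21_pow m : f2 (f1 m.-th) = rho1 m *: f1 m.+1.-th.
Proof.
elim: m => [|m IHm].
  by rewrite fpow0 (good_f1 w_good) linear0 qnum0 mul0r scale0r.
have eq_m := f221 m.-th.
rewrite IHm linearZ /= scalerDr scalerA -!fpowS in eq_m.
exact: (solve_lin eq_m (s_step_neq0 m) (s_stepV m)).
Qed.

(** The condition f_delta f2^m w = 0 takes the place of the Serre relation used in [f21_pow], with c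
    and q^2 instead of t and q. *)
Lemma f23_pow m : f2 (f3 m.-th) = rho3 m *: f3 m.+1.-th.
Proof.
elim: m => [|m IHm].
  by rewrite fpow0 (good_f3 w_good) linear0 qnum0 mul0r scale0r.
have eq_m : f2 (f3 m.+1.-th) = (c^-1 * rho3 m) *: f2 (f3 m.+1.-th) + c^-1 *: f3 m.+2.-th.
  have := fdelta_pow m; rewrite /fdelta IHm linearZ /= -!fpowS => /eqP.
  rewrite addrAC subr_eq0 => /eqP /(congr1 ( *:%R c^-1)).
  by rewrite scalerDr !scalerA mulVf ?c_neq0 // scale1r.
exact: (solve_lin eq_m (r_step_neq0 m) (r_stepV m)).
Qed.

Definition gcoef m : K := qm m.+1 * t / qn m.+2.

(** The operator g of the overview. The coefficient (t c)^-1 is [rho1 1] times [rho3 1], so that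
    [f213_pow] at 0 only restates this definition. *)
Definition ginv (v : V) : V :=
  f2 (f1 (f3 (f2 v))) - (t * c)^-1 *: f1 (f3 (f2 (f2 v))).

(** The induction rewrites f3 f2^(m+2) w as a multiple of f2 f3 f2^(m+1) w, so that [f221] applies
    to f2 f1 f2; the vector sought then reappears and is solved for. *)
Lemma f213_pow m : f2 (f1 (f3 m.+1.-th)) =
  (rho1 m.+1 * rho3 m.+1) *: f1 (f3 m.+2.-th) + gcoef m *: (f2 ^^ m) (ginv w).
Proof.
elim: m => [|m IHm].
  rewrite /gcoef !fpowS !fpow0 !qnS !qmS !qn1 !qm1 !qnum0 !subr0 !mulr1 !mul1r divff ?t_neq0 //.
  by rewrite /ginv (invfM t c); lin K; ring.
(* [rho3 0] vanishes, which is why the statement starts at the power m+1 of f2. *)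
have r0 : rho3 m.+1 != 0 by rewrite mulf_neq0 ?invr_neq0 ?qmN0.
have eq_f3 : f3 m.+2.-th = (rho3 m.+1)^-1 *: f2 (f3 m.+1.-th).
  by rewrite f23_pow scalerA mulVf // scale1r.
have eq_X : f2 (f1 (f3 m.+2.-th)) = (t^-1 * rho1 m.+1) *: f2 (f1 (f3 m.+2.-th)) +
    1 *: ((t^-1 * rho3 m.+2) *: f1 (f3 m.+3.-th)
          + ((rho3 m.+1)^-1 * t^-1 * gcoef m) *: (f2 ^^ m.+1) (ginv w)).
  rewrite {1}eq_f3 !linearZ /= f221 IHm f23_pow !(linearD, linearZ) /= -!fpowS f23_pow.
  rewrite !linearZ /=; lin K; move: t_neq0 r0; move: t (rho3 m.+1) => T x T0 x0;
    by field; rewrite T0 x0 ?qnN0 ?qmN0.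
rewrite (solve_lin eq_X (s_step_neq0 m.+1) (d := (1 - t^-1 * rho1 m.+1)^-1)); last first.
  exact: (esym (mulVf (s_step_neq0 _))).
rewrite s_step /gcoef; lin K.
- move: t_neq0 (qnN0 m.+1) (qnN0 m.+2).
  move: t (qn m.+2) (qn m.+3) (rho3 m.+2) => T x y z T0 x0 y0.
  by field; rewrite T0 x0 y0 ?qmN0.
- move: t_neq0 (qnN0 m.+1) (qnN0 m.+2) (qmN0 m.+1) (qmN0 m).
  move: t (qn m.+2) (qn m.+3) (qm m.+2) (qm m.+1) => T x y z u T0 x0 y0 z0 u0.
  by field; rewrite T0 x0 y0 z0 u0 qmN0.
Qed.

(** By [f21_pow] and [f213_pow], all terms lie in the span of f1 f3 f2^3 w and f2 g w; the
    coefficients of the first cancel. *)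
Lemma fdelta_f12 : D (f1 (f2 w)) = (2 - c) *: f2 (ginv w).
Proof.
have y0 := f213_pow 0; have y1 := f213_pow 1; have x1 := f21_pow 1; have x2 := f21_pow 2.
rewrite !fpowS !fpow0 in y0 y1 x1 x2; move: (ginv w) y0 y1 => g y0 y1.
rewrite /fdelta -!f13 y0 x1 !(linearD, linearZ) /= x2 -!f13 y1.
rewrite !(linearD, linearZ) /= -?f13 ?y1.
(* Both sides are [3]. After this, t and c can be treated as independent variables. *)
have tt : t * t - 1 = 1 + c by field.
lin K; move: t_neq0 c_neq0 c1_neq0 (qmN0 2);
  rewrite /gcoef !qnS !qmS !qn1 !qm1 !qnum0 !subr0 !mulr1 tt;
  move: t c => T C t0 c0 c10 qm30; by field; rewrite t0 c0 c10 qm30.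
Qed.

Lemma k1_pow m : k1 m.-th = q ^+ m *: m.-th.
Proof.
elim: m => [|m IHm]; first by rewrite scale1r good_k1.
by rewrite fpowS (opKF_weight _ IHm) /cartan /= opprK exprS.
Qed.

Lemma k3_pow m : k3 m.-th = (q ^+ 2) ^+ m *: m.-th.
Proof.
elim: m => [|m IHm]; first by rewrite scale1r good_k3.
by rewrite fpowS (opKF_weight _ IHm) /cartan /= opprK -exprnP [in RHS]exprS.
Qed.

Lemma e1_pow m : e1 m.-th = 0.
Proof.
elim: m => [|m IHm]; first exact: good_e1.
by rewrite fpowS opEF_neq // IHm linear0.
Qed.

Lemma e3_pow m : e3 m.-th = 0.
Proof.
elim: m => [|m IHm]; first exact: good_e3.
by rewrite fpowS opEF_neq // IHm linear0.
Qed.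

Lemma f11_pow1 : f1 (f1 (f2 w)) = 0.
Proof. by rewrite f112 (good_f1 w_good) !(linear0, addr0). Qed.

Lemma f33_pow1 : f3 (f3 (f2 w)) = 0.
Proof. by rewrite f332 (good_f3 w_good) !(linear0, addr0). Qed.

(** Since f1^2 f2 w = 0, the Serre relation gives f1 f2 f1 f3 f2 w = t^-1 f1^2 f2 f3 f2 w, which is
    (t c)^-1 f1^2 f3 f2^2 w by [f23_pow]. This matches the second term of g. *)
Lemma f1_ginv : f1 (ginv w) = 0.
Proof.
have x1 := f23_pow 1; rewrite !fpowS !fpow0 !qmS qm1 qnum0 in x1.
have eq1 v : f1 (f2 (f1 v)) = t^-1 *: (f1 (f1 (f2 v)) + f2 (f1 (f1 v))).
  by rewrite f112 subrK scalerA mulVf ?t_neq0 // scale1r.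
rewrite /ginv linearB linearZ /= eq1 x1 [f1 (f3 _)]f13 [f1 (f3 _)]f13 f11_pow1.
rewrite !linearZ !linear0 /= addr0 scalerA.
by lin K; move: t_neq0 c_neq0; move: t c => T C t0 c0; field; rewrite t0 c0.
Qed.

Lemma f3_ginv : f3 (ginv w) = 0.
Proof.
have x1 := f21_pow 1; rewrite !fpowS !fpow0 !qnS qn1 qnum0 in x1.
have eq1 v : f3 (f2 (f3 v)) = c^-1 *: (f3 (f3 (f2 v)) + f2 (f3 (f3 v))).
  by rewrite f332 subrK scalerA mulVf ?c_neq0 // scale1r.
rewrite /ginv linearB linearZ /= !f13 eq1 -!f13 f33_pow1 x1 !linear0.
rewrite !linearZ /= -!f13.
by lin K; move: t_neq0 c_neq0; move: t c => T C t0 c0; field; rewrite t0 c0.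
Qed.

(** One evaluation writes g w as f2 and f3 acting on f1 f2 w, moves f_delta inwards and uses
    [fdelta_f12]; the other expands f_delta and uses f3 g w = 0. Comparing them shows that twice a
    vector is zero. *)
Lemma fdelta_ginv : D (ginv w) = 0.
Proof.
have x1 := f21_pow 1; rewrite !fpowS !fpow0 in x1.
have eq_f122 : f1 (f2 (f2 w)) = t *: f2 (f1 (f2 w)).
  by rewrite x1 !qnS qn1 qnum0 subr0 mulr1 scalerA div1r divff ?t_neq0 // scale1r.
set w' := ginv w.
(* The two expressions of D w' differ by the factors 2 - c and - c. *)
have eq1 : D w' = (2 - c) *: (f2 (f3 (f2 w')) - c^-1 *: f3 (f2 (f2 w'))).
  rewrite {1}/w' /ginv fdeltaB fdeltaZ !f13 fdelta_f2 !fdelta_f3 eq_f122.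
  rewrite fdeltaZ fdelta_f2 fdelta_f12 !linearZ /= -/w'.
  by lin K; move: t_neq0 c_neq0; move: t c => T C t0 c0; field; rewrite ?t0 ?c0.
have eq2 : D w' = (- c) *: (f2 (f3 (f2 w')) - c^-1 *: f3 (f2 (f2 w'))).
  rewrite /fdelta f3_ginv !linear0.
  by lin K; move: c_neq0; move: c => C c0; field; rewrite ?c0.
move: eq1 eq2 => eq1 eq2.
suff X0 : f2 (f3 (f2 w')) - c^-1 *: f3 (f2 (f2 w')) = 0 by rewrite eq1 X0 scaler0.
move: eq1; rewrite eq2 => /eqP; rewrite -subr_eq0 -scalerBl scaler_eq0.
rewrite (_ : - c - (2 - c) = - 2) ?oppr_eq0 ?(negPf two_neq0) /=; last by ring.
by move/eqP.
Qed.

(** The q^h1-weights of f3 f2 w and f3 f2^2 w are q and q^2, so e1 removes f1 with the factors [1]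
    and [2] = t; what is left cancels by [f23_pow]. *)
Lemma e1_ginv : e1 (ginv w) = 0.
Proof.
have x1 := f23_pow 1; rewrite !fpowS !fpow0 !qmS qm1 qnum0 in x1.
have k1f v a : k1 v = a *: v -> k1 (f3 v) = a *: f3 v.
  by move/(opKF_weight i3); rewrite /cartan /= oppr0 expr0z mul1r.
rewrite /ginv linearB linearZ /= opEF_neq // (@opEF_eq _ _ q) //; last exact: (k1f _ _ (k1_pow 1)).
rewrite (@opEF_eq _ _ (q ^+ 2)) ?q2_neq0 //; last exact: (k1f _ _ (k1_pow 2)).
rewrite [e1 (f3 _)]opEF_neq // [e1 (f3 _)]opEF_neq // (e1_pow 1) (e1_pow 2).
rewrite !linear0 !add0r linearZ /= x1.
move: (qsubV_neq0 q_neq0 q_nroot) => qq0.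
lin K; have -> : q ^+ 2 - q ^- 2 = (q - q^-1) * t by field.
by move: t_neq0 c_neq0; move: (q - q^-1) t c qq0 => Q T C Q0 t0 c0; field; rewrite Q0 t0 c0.
Qed.

Lemma e3_ginv : e3 (ginv w) = 0.
Proof.
have x1 := f21_pow 1; rewrite !fpowS !fpow0 !qnS qn1 qnum0 in x1.
have k3f v a : k3 v = a *: v -> k3 (f1 v) = a *: f1 v.
  by move/(opKF_weight i1); rewrite /cartan /= oppr0 expr0z mul1r.
rewrite /ginv linearB linearZ /= !f13 opEF_neq //.
rewrite (@opEF_eq _ _ (q ^+ 2)) ?q2_neq0 //; last exact: (k3f _ _ (k3_pow 1)).
rewrite (@opEF_eq _ _ ((q ^+ 2) ^+ 2)) ?expf_neq0 //; last exact: (k3f _ _ (k3_pow 2)).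
rewrite [e3 (f1 _)]opEF_neq // [e3 (f1 _)]opEF_neq // (e3_pow 1) (e3_pow 2).
rewrite !linear0 !add0r linearZ /= x1.
move: (qsubV_neq0 q_neq0 q_nroot) => qq0.
lin K; have -> : (q ^+ 2) ^+ 2 - (q ^+ 2) ^- 2 = (q - q^-1) * t * c by field.
have -> : q ^+ 2 - q ^- 2 = (q - q^-1) * t by field.
by move: t_neq0 c_neq0; move: (q - q^-1) t c qq0 => Q T C Q0 t0 c0; field; rewrite Q0 t0 c0.
Qed.

(** g lowers the weight by alpha_1 + 2 alpha_2 + alpha_3 = eps_1 + eps_2, which is orthogonal to
    alpha_1 and alpha_3. *)
Lemma k_ginv i a : opK A i w = a *: w ->
  opK A i (ginv w) = (q ^ (- (cartan i i1 + 2%:Z * cartan i i2 + cartan i i3)) * a) *: ginv w.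
Proof.
move=> kw; rewrite /ginv linearB linearZ /=.
rewrite !(opKF_weight _ (opKF_weight _ (opKF_weight _ (opKF_weight _ kw)))).
set P := (X in X *: _ - _); set Q := (X in _ - _ *: (X *: _)); set wt := (X in _ = X *: _).
have -> : P = wt by rewrite /P /wt !mulrA -!expfzDr //; congr (q ^ _ * _); ring.
have -> : Q = wt by rewrite /Q /wt !mulrA -!expfzDr //; congr (q ^ _ * _); ring.
by rewrite scalerBr !scalerA [wt * _]mulrC.
Qed.

Lemma good_ginv : good (ginv w).
Proof.
split.
- exact: f1_ginv.
- exact: f3_ginv.
- exact: fdelta_ginv.
- exact: e1_ginv.
- exact: e3_ginv.
- have /k_ginv -> : k1 w = 1 *: w by rewrite scale1r good_k1.
  by rewrite /cartan /= mulr1 scale1r.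
- have /k_ginv -> : k3 w = 1 *: w by rewrite scale1r good_k3.
  by rewrite /cartan /= mulr1 scale1r.
Qed.

End Good.

(** * Powers of the lowering operators *)

Lemma fpowSr (g : {linear V -> V}) n v : (g ^^ n.+1) v = (g ^^ n) (g v).
Proof. exact: iterSr. Qed.

Lemma fpowD (g : {linear V -> V}) m n v : (g ^^ (m + n)) v = (g ^^ m) ((g ^^ n) v).
Proof. exact: iterD. Qed.

Lemma fpow_lin0 (g : {linear V -> V}) n : (g ^^ n) 0 = 0.
Proof. by elim: n => // n IHn; rewrite fpowS IHn linear0. Qed.

Lemma fpow_linZ (g : {linear V -> V}) n a v : (g ^^ n) (a *: v) = a *: (g ^^ n) v.
Proof. by elim: n => // n IHn; rewrite !fpowS IHn linearZ. Qed.

Lemma fpow_comm (g h : {linear V -> V}) n v : (forall x, g (h x) = h (g x)) ->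
  g ((h ^^ n) v) = (h ^^ n) (g v).
Proof. by move=> gh; elim: n => // n IHn; rewrite !fpowS gh IHn. Qed.

Lemma fpow_fpow (g h : {linear V -> V}) m n v : (forall x, g (h x) = h (g x)) ->
  (g ^^ m) ((h ^^ n) v) = (h ^^ n) ((g ^^ m) v).
Proof.
by move=> gh; elim: m => // m IHm; rewrite !fpowS IHm fpow_comm.
Qed.

Lemma f1_pow_f2 n v : (f1 ^^ n.+1) (f2 v) =
  qn n.+1 *: f1 (f2 ((f1 ^^ n) v)) - qn n *: f2 ((f1 ^^ n.+1) v).
Proof.
elim: n => [|n IHn]; first by rewrite !fpowS !fpow0 qn1 qnum0 scale1r scale0r subr0.
rewrite fpowS IHn linearB !linearZ /= f112 -!fpowS qnS.
by lin K; ring.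
Qed.

Lemma f3_pow_f2 n v : (f3 ^^ n.+1) (f2 v) =
  qm n.+1 *: f3 (f2 ((f3 ^^ n) v)) - qm n *: f2 ((f3 ^^ n.+1) v).
Proof.
elim: n => [|n IHn]; first by rewrite !fpowS !fpow0 qm1 qnum0 scale1r scale0r subr0.
rewrite fpowS IHn linearB !linearZ /= f332 -!fpowS qmS.
by lin K; ring.
Qed.

(** Both terms of [f1_pow_f2] contain f1^(m+1) f2^m w. This is the source of the bound i <= m on the
    spanning vectors. *)
Lemma f1_pow_top w m : good w -> (f1 ^^ m.+1) ((f2 ^^ m) w) = 0.
Proof.
move=> gw; elim: m => [|m IHm]; first by rewrite fpowS !fpow0 good_f1.
by rewrite [(f2 ^^ m.+1) w]fpowS f1_pow_f2 [(f1 ^^ m.+2) _]fpowS IHm !(linear0, addr0).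
Qed.

Lemma f3_pow_top w m : good w -> (f3 ^^ m.+1) ((f2 ^^ m) w) = 0.
Proof.
move=> gw; elim: m => [|m IHm]; first by rewrite fpowS !fpow0 good_f3.
by rewrite [(f2 ^^ m.+1) w]fpowS f3_pow_f2 [(f3 ^^ m.+2) _]fpowS IHm !(linear0, addr0).
Qed.

(** * Strings of a single simple root, as for quantum sl(2) *)

Section Raising.
Variables (i : 'I_3) (p : K).
Hypotheses (p_neq0 : p != 0) (p_nroot : forall n, (0 < n)%N -> p ^+ n != 1).
Hypothesis cartan_p : q ^ cartan i i = p ^+ 2.
Variables (m : nat) (v : V).
Hypotheses (e_v : opE A i v = 0) (k_v : opK A i v = p ^+ m *: v).

Lemma opK_pow n : opK A i ((opF A i ^^ n) v) = (p ^+ m / (p ^+ 2) ^+ n) *: (opF A i ^^ n) v.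
Proof.
elim: n => [|n IHn]; first by rewrite divr1.
rewrite fpowS (opKF_weight _ IHn) -invr_expz cartan_p; congr (_ *: _).
by rewrite mulrCA -invfM -exprS.
Qed.

(** The usual sl(2) formula in the parameter p of the root. The factor (p - p^-1) / (q - q^-1)
    appears because the commutator of e_i and f_i is normalised by q - q^-1 for every i. *)
Lemma raise_step n : (n < m)%N -> opE A i ((opF A i ^^ n.+1) v) =
  ((p - p^-1) / (q - q^-1) * (qnum p n.+1 * qnum p (m - n))) *: (opF A i ^^ n) v.
Proof.
have q0 := qsubV_neq0 q_neq0 q_nroot; have p0 := qsubV_neq0 p_neq0 p_nroot.
elim: n => [|n IHn] lt_nm; rewrite fpowS (opEF_eq _ (opK_pow _)) ?mulf_neq0 ?invr_neq0 ?expf_neq0 //.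
  rewrite !fpow0 e_v linear0 add0r qnum1 // subn0 qnum.unlock.
  congr (_ *: _); rewrite divr1.
  move: (q - q^-1) (p - p^-1) q0 p0 (_ - _) => x y x0 y0 z.
  by field; rewrite x0 y0.
rewrite IHn ?(ltnW lt_nm) // linearZ /= -fpowS -scalerDl; congr (_ *: _).
have [d ->] : exists d, m = (n.+2 + d)%N by exists (m - n.+2)%N; rewrite subnKC.
have -> : (n.+2 + d - n = d.+2)%N by rewrite !addSn -!addnS addKn.
have -> : (n.+2 + d - n.+1 = d.+1)%N by rewrite addSn -addnS addKn.
rewrite qnum.unlock !exprD !exprS expr0 !exprMn expr1n.
have := expf_neq0 n p_neq0; have := expf_neq0 d p_neq0.
have p21 : p * p - 1 != 0 by rewrite -expr2 subr_eq0 p_nroot.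
move: (q - q^-1) q0 (p ^+ n) (p ^+ d) => z z0 x y y0 x0.
by field; rewrite p_neq0 p21 y0 x0 z0.
Qed.

Lemma raise_pow n : (n <= m)%N ->
  exists2 a, a != 0 & (opE A i ^^ n) ((opF A i ^^ n) v) = a *: v.
Proof.
elim: n => [|n IHn] le_nm; first by exists 1; rewrite ?oner_eq0 // scale1r.
have [a a0 eq_a] := IHn (ltnW le_nm).
rewrite fpowSr raise_step // fpow_linZ eq_a scalerA; eexists; last by [].
rewrite !mulf_neq0 ?invr_neq0 ?(qsubV_neq0 q_neq0) ?(qsubV_neq0 p_neq0) ?qnum_neq0 //.
by rewrite -(ltn_predK (_ : 0 < m - n)%N) ?subn_gt0 // qnum_neq0.
Qed.

Lemma raise_top n l : (n <= m)%N -> (n < l)%N -> (opE A i ^^ l) ((opF A i ^^ n) v) = 0.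
Proof.
move=> le_nm lt_nl; have [a _ eq_a] := raise_pow le_nm.
by rewrite -(subnK lt_nl) fpowD fpowS eq_a linearZ /= e_v scaler0 fpow_lin0.
Qed.

End Raising.

(** g is applied here to a vector f1 f3 f2 w because e2 g^(k+1) 1 contains the term g e2 g^k 1, and
    e2 g^k 1 has that shape. *)
Lemma ginv_f132 w : good w ->
  ginv (f1 (f3 (f2 w))) = (t * (c - 1) / c) *: f1 (f3 (f2 (ginv w))).
Proof.
move=> gw; have y0 := f213_pow gw 0; have y1 := f213_pow gw 1.
have x1 := f21_pow gw 2; have z1 := f23_pow gw 2.
have g1 := good_f1 (good_ginv gw); have g3 := good_f3 (good_ginv gw).
rewrite !fpowS !fpow0 in y0 y1 x1 z1.
rewrite {1}/ginv; move: (ginv w) y0 y1 g1 g3 => g y0 y1 g1 g3.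
have f211 v : f2 (f1 (f1 v)) = t *: f1 (f2 (f1 v)) - f1 (f1 (f2 v)).
  by rewrite f112 opprB addrC subrK.
have f233 v : f2 (f3 (f3 v)) = c *: f3 (f2 (f3 v)) - f3 (f3 (f2 v)).
  by rewrite f332 opprB addrC subrK.
rewrite y0 !(linearD, linearZ) /= y1 g3 !(linearD, linearZ, linear0) /=.
have -> : f3 (f1 (f3 (f2 (f2 w)))) = f1 (f3 (f3 (f2 (f2 w)))) by rewrite -f13.
rewrite f211 f233 z1.
have -> : f1 (f3 (f3 (f2 (f2 w)))) = f3 (f3 (f1 (f2 (f2 w)))) by rewrite !f13.
rewrite f233 x1 -!f13 y1 !(linearD, linearZ, linearN) /= -!f13 !(linearD, linearZ, linearN) /=.
have cE : c = t * t - 2 by field.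
by lin K; move: t_neq0 c_neq0 c1_neq0 (qnN0 2) (qmN0 2);
  rewrite /gcoef !qnS !qmS !qn1 !qm1 !qnum0 !subr0 !mulr1;
  move: t c cE => T C ->; move=> t0 c0 c10 qn30 qm30; field; rewrite ?t0 ?c0 ?c10 ?qn30 ?qm30.
Qed.

(** Each f2 in g contributes a commutator with e2. The one ending in f3 w vanishes and the others
    are multiples of f1 f3 f2 w. *)
Lemma e2_ginv w a : good w -> a != 0 -> k2 w = a *: w ->
  e2 (ginv w) = ((q ^+ 3 * a - (q ^+ 3 * a)^-1) / ((q - q^-1) * c)) *: f1 (f3 (f2 w))
              + ginv (e2 w).
Proof.
move=> gw a0 kw.
have k2w : k2 (f2 w) = (q ^- 2 * a) *: f2 w by rewrite (opKF_weight _ kw).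
have k2w' : k2 (f1 (f3 (f2 w))) = (q * a) *: f1 (f3 (f2 w)).
  rewrite !(opKF_weight _ (opKF_weight _ k2w)); congr (_ *: _).
  by rewrite /cartan /= !opprK expr1z -exprnP mulrA; field.
rewrite /ginv linearB linearZ /= (opEF_eq _ k2w') ?mulf_neq0 //.
rewrite ![e2 (f1 _)]opEF_neq // ![e2 (f3 _)]opEF_neq //.
rewrite (opEF_eq _ k2w) ?mulf_neq0 ?invr_neq0 ?expf_neq0 // (opEF_eq _ kw) //.
rewrite !(linearD, linearZ) /= (good_f3 gw) !linear0.
have q21 : q * q - 1 != 0 by rewrite -expr2 subr_eq0 q_nroot.
have t0 : q * q + 1 != 0.
  by rewrite (_ : q * q + 1 = q * t) ?mulf_neq0 ?t_neq0 //; field.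
have c0 : (q * q) ^+ 2 + 1 != 0.
  by rewrite (_ : _ + 1 = q ^+ 2 * c) ?mulf_neq0 ?c_neq0 ?expf_neq0 //; field.
by lin K; field; rewrite q_neq0 t0 c0 q21 a0.
Qed.

(** * The module generated by a good highest vector *)

Section Module.
Variables (hv : V) (kappa : K).
Hypotheses (hv_good : good hv) (e2_hv : e2 hv = 0) (k2_hv : k2 hv = kappa *: hv).
Hypothesis kappa2 : kappa ^+ 2 = - q ^- 2.

Let w k := iter k ginv hv.

Lemma kappa_neq0 : kappa != 0.
Proof.
have : kappa ^+ 2 != 0 by rewrite kappa2 oppr_eq0 invr_eq0 expf_neq0.
by rewrite expf_eq0.
Qed.

(** Inversion changes the sign of kappa up to a power of q, which turns the differences z - z^-1 in
    the commutators into kappa times a sum of powers of q. *)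
Lemma kappaV : kappa^-1 = - (kappa * q ^+ 2).
Proof.
apply: (mulfI kappa_neq0); rewrite divff ?kappa_neq0 // mulrN mulrA -expr2 kappa2.
by field.
Qed.

Lemma w_good k : good (w k).
Proof. by elim: k => [|k IHk] //; apply: good_ginv. Qed.

Lemma k2_w k : k2 (w k) = (kappa / q ^+ k) *: w k.
Proof.
elim: k => [|k IHk]; first by rewrite divr1.
rewrite /w iterS (k_ginv IHk); congr (_ *: _).
by rewrite /cartan /= exprS invfM mulrCA.
Qed.

(** In [e2_ginv] both terms are multiples of the same vector, the second by the induction hypothesis
    and [ginv_f132]. *)
Lemma e2_w k : e2 (w k.+1) =
  (qn k.+1 * (kappa * q) / (q - q^-1)) *: f1 (f3 (f2 (w k))).
Proof.
have q21 : q * q - 1 != 0 by rewrite -expr2 subr_eq0 q_nroot.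
have t0 : q * q + 1 != 0.
  by rewrite (_ : q * q + 1 = q * t) ?mulf_neq0 ?t_neq0 //; field.
have c0 : (q * q) ^+ 2 + 1 != 0.
  by rewrite (_ : _ + 1 = q ^+ 2 * c) ?mulf_neq0 ?c_neq0 ?expf_neq0 //; field.
have ka0 := kappa_neq0.
have kV n : (q ^+ 3 * (kappa / q ^+ n))^-1 = - (kappa * q ^+ n / q).
  by rewrite !invfM kappaV invrK; field; rewrite ?expf_neq0.
elim: k => [|k IHk].
  rewrite /w /= (e2_ginv hv_good kappa_neq0 k2_hv) e2_hv /ginv !(linear0, addr0).
  have := kV 0; rewrite expr0 divr1 mulr1 => ->; rewrite qn1; congr (_ *: _).
  by field; rewrite q_neq0 ?c0 q21.
rewrite {1}/w iterS -/(w k.+1) (e2_ginv (w_good k.+1) _ (k2_w k.+1)); last first.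
  by rewrite mulf_neq0 ?invr_neq0 ?expf_neq0.
rewrite IHk kV.
have -> a : ginv (a *: f1 (f3 (f2 (w k)))) = a *: ginv (f1 (f3 (f2 (w k)))).
  by rewrite /ginv !linearZ /=; lin K; ring.
rewrite (ginv_f132 (w_good k)) -[ginv (w k)]/(w k.+1) scalerA -scalerDl; congr (_ *: _).
rewrite qnum.unlock !exprS.
have := expf_neq0 k q_neq0; move: (q ^+ k) => X X0.
by field; rewrite q_neq0 q21 X0 -(expr2 (q * q)) c0.
Qed.

(** The usual coefficient [m+1] (kappa q^-m - kappa^-1 q^m) / (q - q^-1) becomes kappa q [2m+2] / (q
    - q^-1) by [kappaV], and [2m+2] is t times [m+1] in q^2. Hence it never vanishes. *)
Lemma e2_pow_hv m : e2 ((f2 ^^ m.+1) hv) =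
  (kappa * q * t / (q - q^-1) * qm m.+1) *: (f2 ^^ m) hv.
Proof.
have q21 : q * q - 1 != 0 by rewrite -expr2 subr_eq0 q_nroot.
have t0 : q * q + 1 != 0.
  by rewrite (_ : q * q + 1 = q * t) ?mulf_neq0 ?t_neq0 //; field.
have q41 : q * q * (q * q) - 1 != 0.
  by rewrite -!expr2 -exprM subr_eq0 q_nroot.
have ka0 := kappa_neq0.
have k2_pow n : k2 ((f2 ^^ n) hv) = (kappa / (q ^+ 2) ^+ n) *: (f2 ^^ n) hv.
  elim: n => [|n IHn]; first by rewrite divr1.
  rewrite fpowS (opKF_weight _ IHn); congr (_ *: _).
  by rewrite /cartan /= [_ ^+ n.+1]exprS invfM mulrCA.
have kV n : (kappa / (q ^+ 2) ^+ n)^-1 = - (kappa * q ^+ 2 * (q ^+ 2) ^+ n).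
  by rewrite invf_div kappaV; ring.
elim: m => [|m IHm]; rewrite fpowS (opEF_eq _ (k2_pow _)) ?mulf_neq0 ?invr_neq0 ?expf_neq0 // kV.
  rewrite fpow0 e2_hv linear0 add0r qm1; congr (_ *: _).
  by field; rewrite q_neq0 q21 oner_eq0.
rewrite IHm linearZ /= -fpowS -scalerDl; congr (_ *: _).
rewrite qnum.unlock !exprS !exprMn expr1n expr0.
have := expf_neq0 m q_neq0; move: (q ^+ m) => X X0.
by field; rewrite q_neq0 q41 X0 q21.
Qed.

Lemma opEK_eq0 i j v : opE A i v = 0 -> opE A i (opK A j v) = 0.
Proof.
move=> ev; have := opKE A j i v; rewrite ev linear0 => /esym/eqP.
by rewrite scaler_eq0 expfz_eq0 (negPf q_neq0) andbF => /eqP.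
Qed.

Lemma opEKV_eq0 i j v : opE A i v = 0 -> opE A i (opKV A j v) = 0.
Proof.
move=> ev; rewrite -[LHS](opKVK A j) opKE opKK ev scaler0; exact: linear0.
Qed.

(** Commuting e2 with f2 produces only q^h2 and its inverse on f2^m v, and e1 kills these terms. *)
Lemma e312_pow v m : good v -> e3 (e1 (e2 ((f2 ^^ m) v))) = (f2 ^^ m) (e3 (e1 (e2 v))).
Proof.
move=> gv; elim: m => [|m IHm] //.
rewrite !fpowS opEF eqxx scale1r !(linearD, linearZ, linearN) /=.
rewrite (opEK_eq0 _ (e1_pow gv m)) (opEKV_eq0 _ (e1_pow gv m)) !(linear0, addr0).
by rewrite opEF_neq // opEF_neq // IHm.
Qed.

(** e3 e1 e2 trades one factor g for one factor f2. *)
Lemma e312_w m k : e3 (e1 (e2 ((f2 ^^ m) (w k.+1)))) =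
  (qn k.+1 * (kappa * q) / (q - q^-1) * t) *: (f2 ^^ m.+1) (w k).
Proof.
have gw := w_good k; rewrite (e312_pow m (w_good k.+1)) e2_w !linearZ /=.
have k1w : k1 (f3 (f2 (w k))) = q *: f3 (f2 (w k)).
  by rewrite (opKF_weight _ (k1_pow gw 1)) /cartan /= oppr0 expr0z mul1r.
have -> : e3 (e1 (f1 (f3 (f2 (w k))))) = t *: f2 (w k).
  rewrite (opEF_eq _ k1w) // opEF_neq // (e1_pow gw 1) !linear0 add0r.
  rewrite divff ?(qsubV_neq0 q_neq0) // scale1r (opEF_eq _ (k3_pow gw 1)) ?expf_neq0 //.
  rewrite (e3_pow gw 1) linear0 add0r; congr (_ *: _).
  have q21 : q * q - 1 != 0 by rewrite -expr2 subr_eq0 q_nroot.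
  by field; rewrite q_neq0 q21.
by rewrite !fpow_linZ scalerA -fpowSr.
Qed.

Lemma e312_w0 m : e3 (e1 (e2 ((f2 ^^ m) hv))) = 0.
Proof. by rewrite e312_pow // e2_hv !linear0 fpow_lin0. Qed.

Let T v := e3 (e1 (e2 v)).

Lemma T_lin a v : T (a *: v) = a *: T v.
Proof. by rewrite /T !linearZ. Qed.

Lemma iter_T_lin n a v : iter n T (a *: v) = a *: iter n T v.
Proof. by elim: n => //= n ->; rewrite T_lin. Qed.

Lemma iter_T k m : exists2 a, a != 0 & iter k T ((f2 ^^ m) (w k)) = a *: (f2 ^^ (m + k)) hv.
Proof.
elim: k m => [|k IHk] m; first by exists 1; rewrite ?oner_eq0 // scale1r addn0.
have [a a0 eq_a] := IHk m.+1.
rewrite iterSr [T _]e312_w iter_T_lin eq_a scalerA addSnnS; eexists; last by [].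
by rewrite !mulf_neq0 ?invr_neq0 ?qnN0 ?kappa_neq0 ?(qsubV_neq0 q_neq0) ?t_neq0.
Qed.

Lemma iter_T0 k l m : (k < l)%N -> iter l T ((f2 ^^ m) (w k)) = 0.
Proof.
move=> lt_kl; have [a _ eq_a] := iter_T k m.
rewrite -(subnK lt_kl) iterD iterS eq_a T_lin [T _]e312_w0 scaler0.
by elim: (l - _)%N => //= n ->; rewrite /T !linear0.
Qed.

Lemma e2_iter m : exists2 a, a != 0 & (e2 ^^ m) ((f2 ^^ m) hv) = a *: hv.
Proof.
elim: m => [|m [a a0 eq_a]]; first by exists 1; rewrite ?oner_eq0 // scale1r.
rewrite fpowSr e2_pow_hv fpow_linZ eq_a scalerA; eexists; last by [].
by rewrite !mulf_neq0 ?invr_neq0 ?qmN0 ?kappa_neq0 ?(qsubV_neq0 q_neq0) ?t_neq0.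
Qed.

Lemma e2_iter0 l m : (m < l)%N -> (e2 ^^ l) ((f2 ^^ m) hv) = 0.
Proof.
move=> lt_ml; have [a _ eq_a] := e2_iter m.
by rewrite -(subnK lt_ml) fpowD fpowS eq_a linearZ /= e2_hv scaler0 fpow_lin0.
Qed.

(** The products [*l] carry the lexicographic order in which leading terms are taken. *)
Definition vec_index := (nat *l nat *l nat *l nat)%type.

Definition vec (x : vec_index) : V :=
  let: (i, j, k, m) := x in (f1 ^^ i) ((f3 ^^ j) ((f2 ^^ m) (w k))).

Definition valid (x : vec_index) : bool :=
  let: (i, j, k, m) := x in (i <= m)%N && (j <= m)%N.

Definition lower (x : vec_index) (v : V) : V :=
  let: (i, j, k, m) := x in
  (e2 ^^ (m + k)) (iter k T ((e3 ^^ j) ((e1 ^^ i) v))).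

Lemma e1_f3_pow j k m : e1 ((f3 ^^ j) ((f2 ^^ m) (w k))) = 0.
Proof.
rewrite fpow_comm; last by move=> x; rewrite opEF_neq.
by rewrite (e1_pow (w_good k)) fpow_lin0.
Qed.

Lemma k1_f3_pow j k m :
  k1 ((f3 ^^ j) ((f2 ^^ m) (w k))) = q ^+ m *: (f3 ^^ j) ((f2 ^^ m) (w k)).
Proof.
rewrite fpow_comm; last by move=> x; rewrite opKF /cartan /= oppr0 expr0z scale1r.
by rewrite (k1_pow (w_good k)) fpow_linZ.
Qed.

(** The q^h1- and q^h3-weights of f2^m g^k 1 are q^m and (q^2)^m, so the f1- and f3-strings are
    treated with p = q and p = q^2, both with top weight m. *)
Definition e1_raise j k m := @raise_pow i1 q q_neq0 q_nroot erefl m _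
  (e1_f3_pow j k m) (k1_f3_pow j k m).
Definition e1_top j k m := @raise_top i1 q q_neq0 q_nroot erefl m _
  (e1_f3_pow j k m) (k1_f3_pow j k m).

Lemma cartan33 : q ^ cartan i3 i3 = (q ^+ 2) ^+ 2.
Proof. by rewrite -exprM. Qed.

Definition e3_raise k m := @raise_pow i3 _ q2_neq0 q2_nroot cartan33 m _
  (e3_pow (w_good k) m) (k3_pow (w_good k) m).
Definition e3_top k m := @raise_top i3 _ q2_neq0 q2_nroot cartan33 m _
  (e3_pow (w_good k) m) (k3_pow (w_good k) m).

(** The powers of e1 and e3 undo those of f1 and f3, the power of e3 e1 e2 turns g^k into f2^k, and
    the power of e2 removes f2^(m+k). *)
Lemma lower_lead x : valid x -> exists2 a, a != 0 & lower x (vec x) = a *: hv.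
Proof.
case: x => [[[i j] k] m] /andP[le_im le_jm] /=.
have [a a0 ->] := e1_raise j k le_im; rewrite fpow_linZ.
have [b b0 ->] := e3_raise k le_jm; rewrite !iter_T_lin.
have [d d0 ->] := iter_T k m; rewrite !fpow_linZ.
have [g g0 ->] := e2_iter (m + k); rewrite !scalerA.
by eexists; last by []; rewrite !mulf_neq0.
Qed.

Lemma iter_T_0 n : iter n T 0 = 0.
Proof. by elim: n => //= n ->; rewrite /T !linear0. Qed.

(** The operators of [lower x] act in the order of the indices. Equal indices contribute scalars,
    and at the first index that differs the power is too high for [vec y]. *)
Lemma lower_lt x y : valid y -> (y < x)%O -> lower x (vec y) = 0.
Proof.
case: x => [[[i j] k] m]; case: y => [[[i' j'] k'] m'] /andP[le_im le_jm].
rewrite Order.ProdLexiOrder.ltxi_pair !Order.ProdLexiOrder.lexi_pair.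
rewrite !leEnat !ltEnat /=.
case: (ltngtP i' i) => //= [lt_i _|<-].
  by rewrite e1_top // fpow_lin0 iter_T_0 fpow_lin0.
have [a _ ->] := e1_raise j' k' le_im; rewrite fpow_linZ.
case: (ltngtP j' j) => //= [lt_j _|<-].
  by rewrite e3_top // scaler0 iter_T_0 fpow_lin0.
have [b _ ->] := e3_raise k' le_jm; rewrite !iter_T_lin !fpow_linZ.
case: (ltngtP k' k) => //= [lt_k _|<- lt_m].
  by rewrite iter_T0 // fpow_lin0 !scaler0.
have [d _ ->] := iter_T k' m'; rewrite fpow_linZ e2_iter0 ?scaler0 //.
by rewrite ltn_add2r.
Qed.

Lemma lowerD x u v : lower x (u + v) = lower x u + lower x v.
Proof.
have fpowD' (g : {linear V -> V}) n u' v' : (g ^^ n) (u' + v') = (g ^^ n) u' + (g ^^ n) v'.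
  by elim: n => // n IHn; rewrite !fpowS IHn linearD.
have TD n u' v' : iter n T (u' + v') = iter n T u' + iter n T v'.
  by elim: n => //= n ->; rewrite /T !linearD.
by case: x => [[[i j] k] m]; rewrite /lower !(fpowD', TD).
Qed.

Lemma lowerZ x a v : lower x (a *: v) = a *: lower x v.
Proof.
by case: x => [[[i j] k] m]; rewrite /lower !(fpow_linZ, iter_T_lin).
Qed.

(** Lists may repeat an index, so that sums are concatenations; [inspan_lead] collects equal
    indices. *)
Definition inspan (v : V) : Prop := exists2 s : seq (K * vec_index),
  all (fun x => valid x.2) s & v = \sum_(x <- s) x.1 *: vec x.2.

Lemma inspan0 : inspan 0.
Proof. by exists [::]; rewrite ?big_nil. Qed.

Lemma inspanD u v : inspan u -> inspan v -> inspan (u + v).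
Proof.
move=> [s val_s ->] [s' val_s' ->]; exists (s ++ s'); last by rewrite big_cat.
by rewrite all_cat val_s.
Qed.

Lemma inspanZ a v : inspan v -> inspan (a *: v).
Proof.
move=> [s val_s ->]; exists [seq (a * x.1, x.2) | x <- s]; first by rewrite all_map.
by rewrite big_map scaler_sumr; apply: eq_bigr => x _; rewrite scalerA.
Qed.

Lemma inspan_vec x : valid x -> inspan (vec x).
Proof.
move=> val_x; exists [:: (1, x)]; first by rewrite /= val_x.
by rewrite big_seq1 scale1r.
Qed.

Lemma inspan_sum (g : {linear V -> V}) : (forall x, valid x -> inspan (g (vec x))) ->
  forall v, inspan v -> inspan (g v).
Proof.
move=> g_vec v [s val_s ->]; elim: s val_s => [|x s IHs] /=.
  by rewrite big_nil linear0 => _; apply: inspan0.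
move=> /andP[val_x val_s]; rewrite big_cons linearD linearZ.
by apply: inspanD; [apply/inspanZ/g_vec | apply: IHs].
Qed.

Lemma inspan_f1 v : inspan v -> inspan (f1 v).
Proof.
apply: inspan_sum => -[[[i j] k] m] /andP[le_im le_jm].
rewrite /= -fpowS; have [lt_im|ge_im] := ltnP i m.
  by apply: (@inspan_vec (i.+1, j, k, m)); rewrite /= lt_im.
have -> : i = m by apply/eqP; rewrite eqn_leq le_im.
rewrite fpow_fpow; last exact: f13.
rewrite f1_pow_top ?fpow_lin0; [exact: inspan0 | exact: w_good].
Qed.

Lemma inspan_f3 v : inspan v -> inspan (f3 v).
Proof.
apply: inspan_sum => -[[[i j] k] m] /andP[le_im le_jm].
rewrite /= fpow_comm; last by move=> x; rewrite f13.
rewrite -fpowS; have [lt_jm|ge_jm] := ltnP j m.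
  by apply: (@inspan_vec (i, j.+1, k, m)); rewrite /= le_im.
have -> : j = m by apply/eqP; rewrite eqn_leq le_jm.
rewrite f3_pow_top ?fpow_lin0; [exact: inspan0 | exact: w_good].
Qed.

(** [f112] expresses f2 f1^(i+2) through f2 f1^(i+1) and f2 f1^i, so the induction carries two
    consecutive powers. *)
Lemma inspan_f2_f1_pow v : inspan (f2 v) -> inspan (f2 (f1 v)) ->
  forall i, inspan (f2 ((f1 ^^ i) v)).
Proof.
move=> span0 span1 i; suff [] : inspan (f2 ((f1 ^^ i) v)) /\ inspan (f2 ((f1 ^^ i.+1) v)) by [].
elim: i => [|i [IHi IHi1]]; split=> //.
have -> : f2 ((f1 ^^ i.+2) v) =
    t *: f1 (f2 ((f1 ^^ i.+1) v)) + (-1) *: f1 (f1 (f2 ((f1 ^^ i) v))).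
  by rewrite f112 !fpowS; lin K; ring.
by apply: inspanD; apply: inspanZ; do ?apply: inspan_f1.
Qed.

Lemma inspan_f2_f3_pow v : inspan (f2 v) -> inspan (f2 (f3 v)) ->
  forall j, inspan (f2 ((f3 ^^ j) v)).
Proof.
move=> span0 span1 j; suff [] : inspan (f2 ((f3 ^^ j) v)) /\ inspan (f2 ((f3 ^^ j.+1) v)) by [].
elim: j => [|j [IHj IHj1]]; split=> //.
have -> : f2 ((f3 ^^ j.+2) v) =
    c *: f3 (f2 ((f3 ^^ j.+1) v)) + (-1) *: f3 (f3 (f2 ((f3 ^^ j) v))).
  by rewrite f332 !fpowS; lin K; ring.
by apply: inspanD; apply: inspanZ; do ?apply: inspan_f3.
Qed.

(** The powers of f1 and f3 reduce to exponents 0 and 1, which leaves f2, f2 f1, f2 f3 and f2 f1 f3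
    on f2^m g^k 1. *)
Lemma inspan_f2 v : inspan v -> inspan (f2 v).
Proof.
apply: inspan_sum => -[[[i j] k] m] _ /=.
have span0 n : inspan ((f2 ^^ n) (w k)) by apply: (@inspan_vec (0, 0, k, n)).
have span1 : inspan (f2 (f1 ((f2 ^^ m) (w k)))).
  by rewrite (f21_pow (w_good k)); apply/inspanZ/inspan_f1.
have span3 : inspan (f2 (f3 ((f2 ^^ m) (w k)))).
  by rewrite (f23_pow (w_good k)); apply/inspanZ/inspan_f3.
have span13 : inspan (f2 (f1 (f3 ((f2 ^^ m) (w k))))).
  case: (m) => [|n]; first by rewrite fpow0 (good_f3 (w_good k)) !linear0; apply: inspan0.
  rewrite (f213_pow (w_good k)); apply: inspanD; apply: inspanZ.
    by apply/inspan_f1/inspan_f3.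
  exact: (@inspan_vec (0, 0, k.+1, n)).
apply: inspan_f2_f1_pow; first exact: inspan_f2_f3_pow (span0 m.+1) span3 j.
rewrite fpow_comm; last exact: f13.
by apply: inspan_f2_f3_pow => //; rewrite -f13.
Qed.

(** Induction on the length of a combination for v. If the coefficients at the largest index add up
    to 0, that index is dropped; otherwise [lower] at that index sends v to a nonzero multiple of
    hv. *)
Lemma inspan_lead (W : V -> Prop) v :
  (forall a x, W x -> W (a *: x)) -> (forall i x, W x -> W (opE A i x)) ->
  inspan v -> v != 0 -> W v -> W hv.
Proof.
move=> WZ WE [s]; elim: (size s) {-2}s (leqnn (size s)) => [|n IHn] {}s.
  by rewrite leqn0 => /nilP ->; rewrite big_nil => _ ->; rewrite eqxx.
move=> le_s val_s eq_v v_neq0 Wv.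
have [x0 s_x0 max_x0] : exists2 x0, x0 \in [seq x.2 | x <- s] &
    forall y, y \in [seq x.2 | x <- s] -> (y <= x0)%O.
  case: (s) eq_v => [|x s']; first by rewrite big_nil => eq_v; rewrite eq_v eqxx in v_neq0.
  by move=> _; apply: seq_has_max.
have Wlower : W (lower x0 v).
  have Wpow i l y : W y -> W ((opE A i ^^ l) y).
    by move=> Wy; elim: l => // l IHl; rewrite fpowS; apply/WE.
  have WT l y : W y -> W (iter l T y).
    by move=> Wy; elim: l => //= l IHl; do 3!apply/WE.
  by case: (x0) => [[[i j] k] m]; apply/Wpow/WT/Wpow/Wpow.
pose c0 := \sum_(x <- s | x.2 == x0) x.1.
have sum_x0 : \sum_(x <- s | x.2 == x0) x.1 *: vec x.2 = c0 *: vec x0.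
  by rewrite scaler_suml; apply: eq_bigr => x /eqP ->.
have [c00|c0_neq0] := eqVneq c0 0.
  pose s' := [seq x <- s | x.2 != x0].
  apply: (IHn s') => //.
  - rewrite -ltnS (leq_trans _ le_s) // size_filter -(count_predC (fun x => x.2 == x0)).
    rewrite -[ltnLHS]add0n ltn_add2r -has_count; apply/hasP.
    by move/mapP: s_x0 => [x ts_x ->]; exists x.
  - by rewrite /s' all_filter; apply: sub_all val_s => x /= ->; rewrite implybT.
  - by rewrite big_filter eq_v (bigID (fun x => x.2 == x0)) /= sum_x0 c00 scale0r add0r.
have [a a0 eq_a] : exists2 a, a != 0 & lower x0 (vec x0) = a *: hv.
  by apply: lower_lead; move: s_x0 => /mapP[x s_x ->]; apply: (allP val_s).
suff eq_lower : lower x0 v = (c0 * a) *: hv.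
  rewrite eq_lower in Wlower; have := WZ (c0 * a)^-1 _ Wlower.
  by rewrite scalerA mulVf ?scale1r ?mulf_neq0.
rewrite eq_v (bigID (fun x => x.2 == x0)) /= sum_x0 lowerD lowerZ eq_a scalerA.
rewrite -[RHS]addr0; congr (_ + _).
(* The sum is taken over an arbitrary sublist, so that validity and maximality still refer to the
   full list. *)
have : {subset s <= s} by [].
elim: {-2}s => [|x s' IHts] sub_ts.
  by rewrite big_nil; case: (x0) => [[[i j] k] m]; rewrite /lower !(fpow_lin0, iter_T_0).
have {}IHts : lower x0 (\sum_(y <- s' | y.2 != x0) y.1 *: vec y.2) = 0.
  by apply: IHts => y ts_y; apply: sub_ts; rewrite inE ts_y orbT.
rewrite big_cons; case: ifP => // neq_x; rewrite lowerD lowerZ IHts addr0 lower_lt ?scaler0 //.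
  by apply: (allP val_s); apply: sub_ts; rewrite mem_head.
by rewrite lt_neqAle neq_x max_x0 //; apply: map_f; apply: sub_ts; rewrite mem_head.
Qed.

End Module.

End HighestWeight.

(** * Actions of the free algebra *)

Lemma malg_mulAr (F : fieldType) (I : choiceType) (c : F) (x : {malg F[{fmonom I}]}) :
  x * c%:A = c *: x.
Proof.
rewrite -mul_malgC mulr1 malgM_def fgmulgU malgZ_def.
by apply: eq_bigr => m _; rewrite mulm1 mulrC.
Qed.

(** * Modules over a ring under the free algebra, seen as vector spaces *)

Section RestrictScalars.
Variables (F : fieldType) (I : choiceType) (A : pzRingType).
Local Notation freeAlg := {malg F[{fmonom I}]}.
Variables (phi : {rmorphism freeAlg -> A}) (M : lmodType A).

(** The phantom argument records the map [phi] through which scalars act, so that the vector space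
    structure can be inferred from the type. *)
Definition restrict_scalars (_ : {rmorphism freeAlg -> A}) : Type := M.
Local Notation N := (restrict_scalars phi).
HB.instance Definition _ := GRing.Zmodule.on N.

Definition rscale (c : F) (v : N) : N := phi c%:A *: (v : M).

Fact rscaleA a b v : rscale a (rscale b v) = rscale (a * b) v.
Proof. by rewrite /rscale scalerA -rmorphM malg_mulAr scalerA mulrC. Qed.
Fact rscale1 : left_id 1 rscale.
Proof. by move=> v; rewrite /rscale scale1r rmorph1 scale1r. Qed.
Fact rscaleDr : right_distributive rscale +%R.
Proof. by move=> a u v; rewrite /rscale scalerDr. Qed.
Fact rscaleDl v : {morph rscale^~ v : a b / a + b}.
Proof. by move=> a b; rewrite /rscale scalerDl rmorphD scalerDl. Qed.

HB.instance Definition _ := GRing.Zmodule_isLmodule.Build F N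
  rscaleA rscale1 rscaleDr rscaleDl.

Definition act (x : freeAlg) (v : N) : N := phi x *: (v : M).

Fact act_linear x : linear (act x).
Proof.
move=> a u v; rewrite /act scalerDr; congr (_ + _).
rewrite -[a *: u]/(rscale a u) -[RHS]/(rscale a _) /rscale !scalerA -!rmorphM.
by rewrite malg_mulAr -[a%:A]mul_malgC mulr1 mul_malgC.
Qed.
HB.instance Definition _ x :=
  GRing.isLinear.Build F N N _ (act x) (act_linear x).

Lemma actM x y v : act (x * y) v = act x (act y v).
Proof. by rewrite /act scalerA rmorphM. Qed.
Lemma actB x y v : act (x - y) v = act x v - act y v.
Proof. by rewrite /act rmorphB scalerBl. Qed.
Lemma actZ a x v : act (a *: x) v = a *: act x v.
Proof.
rewrite -[RHS]/(rscale a _) /rscale /act scalerA -rmorphM.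
by rewrite -[a%:A]mul_malgC mulr1 mul_malgC.
Qed.
Lemma act1 v : act 1 v = v.
Proof. by rewrite /act rmorph1 scale1r. Qed.

Lemma act_eq0 x v : phi x = 0 -> act x v = 0.
Proof. by rewrite /act => ->; rewrite scale0r. Qed.

End RestrictScalars.

Section UqOf.
Variables (R : realType) (q : R[i]).
Local Notation freeAlg := {malg R[i][{fmonom generator}]}.

Fact Uq_of_zmod_morphism : zmod_morphism (Uq_of q : freeAlg -> Uq q).
Proof. by move=> x y; rewrite /Uq_of raddfB. Qed.
HB.instance Definition _ :=
  GRing.isZmodMorphism.Build freeAlg (Uq q) (Uq_of q) Uq_of_zmod_morphism.

Fact Uq_of_monoid_morphism : monoid_morphism (Uq_of q : freeAlg -> Uq q).
Proof. by split; [exact: pi_ringQuot1 | exact: pi_ringQuotM]. Qed.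
HB.instance Definition _ :=
  GRing.isMonoidMorphism.Build freeAlg (Uq q) (Uq_of q) Uq_of_monoid_morphism.

Lemma Uq_of_relator x : Uq_relator q x -> Uq_of q x = 0.
Proof.
move=> rel_x; apply/eqP; rewrite -[0](raddf0 (\pi_(ringQuot (Uq_relator q)))).
by rewrite ringQuot_eq subr0; apply: mem_ideal_gen.
Qed.

End UqOf.

(** * The free algebra acting through given operators *)

Section WordAction.
Variables (F : fieldType) (I : choiceType) (V : lmodType F).
Variable op : I -> {linear V -> V}.
Local Notation freeAlg := {malg F[{fmonom I}]}.

Definition word (m : {fmonom I}) (v : V) : V := foldr (fun i => op i) v m.

Fact word_linear m : linear (word m).
Proof.
by move=> a u v; rewrite /word; elim: (fmonom_val m) => //= i s ->; rewrite linearP.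
Qed.
HB.instance Definition _ m := GRing.isLinear.Build F V V _ (word m) (word_linear m).

Definition wact (x : freeAlg) (v : V) : V := \sum_(m <- msupp x) x@_m *: word m v.

Lemma wactEw (d : {fset {fmonom I}}) x v : (msupp x `<=` d)%fset ->
  wact x v = \sum_(m <- d) x@_m *: word m v.
Proof.
move=> le_xd; apply: big_fset_incl => // m _ /mcoeff_outdom ->.
by rewrite scale0r.
Qed.

Lemma wactD x y v : wact (x + y) v = wact x v + wact y v.
Proof.
rewrite (wactEw v (msuppD_le x y)) (wactEw v (fsubsetUl (msupp x) (msupp y))).
rewrite (wactEw v (fsubsetUr (msupp x) (msupp y))) -big_split /=.
by apply: eq_bigr => m _; rewrite mcoeffD scalerDl.
Qed.

Lemma wactU c m v : wact (mkmalgU m c) v = c *: word m v.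
Proof. by rewrite (wactEw v msuppU_le) big_seq_fset1 mcoeffUU. Qed.

Lemma wact0 v : wact 0 v = 0.
Proof. by rewrite /wact msupp0 big_seq_fset0. Qed.

Fact wact_linear x : linear (wact x).
Proof.
move=> a u v; rewrite /wact scaler_sumr -big_split /=.
by apply: eq_bigr => m _; rewrite linearP scalerDr !scalerA mulrC.
Qed.
HB.instance Definition _ x := GRing.isLinear.Build F V V _ (wact x) (wact_linear x).

Lemma wact_sum (J : Type) (s : seq J) (x : J -> freeAlg) v :
  wact (\sum_(j <- s) x j) v = \sum_(j <- s) wact (x j) v.
Proof.
by elim: s => [|j s IHs]; rewrite ?big_nil ?wact0 // !big_cons wactD IHs.
Qed.

Lemma wactM x y v : wact (x * y) v = wact x (wact y v).
Proof.
rewrite malgME wact_sum [RHS]/wact; apply: eq_bigr => m _.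
rewrite wact_sum linear_sum scaler_sumr; apply: eq_bigr => n _.
rewrite wactU linearZ scalerA /word; congr (_ *: _).
by rewrite fmM foldr_cat.
Qed.

Lemma wactZ c x v : wact (c *: x) v = c *: wact x v.
Proof. by rewrite -mul_malgC wactM wactU /word fm1. Qed.

Lemma wactB x y v : wact (x - y) v = wact x v - wact y v.
Proof.
have yN : - y = (-1) *: y by rewrite scaleN1r.
by rewrite wactD yN wactZ scaleN1r.
Qed.

Lemma wact1 v : wact 1 v = v.
Proof. by rewrite wactU scale1r /word fm1. Qed.

Lemma wact_gen i v : wact (mkmalgU (fmu i) 1) v = op i v.
Proof. by rewrite wactU scale1r /word fmU. Qed.

End WordAction.

(* The linearity rules are instantiated: with a free linear map, linearN and
   linearZ swap -%R and *:%R forever. *)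
Lemma serre_commutators (F : fieldType) (q : F) (V : lmodType F)
  (x : 'I_3 -> {linear V -> V}) (v : V) : q != 0 ->
  let br (a : F) (y z : V -> V) u := y (z u) - a *: z (y u) in
  [:: br 1 (x i1) (x i3) v;
      br q^-1 (x i1) (br q (x i1) (x i2)) v;
      br q^-1 (x i2) (br q (x i2) (x i1)) v;
      br (q ^- 2) (x i2) (br 1 (x i2) (br (q ^+ 2) (x i2) (x i3))) v;
      br (q ^+ 2) (x i3) (br (q ^- 2) (x i3) (x i2)) v] = serre_ops q x v.
Proof.
move=> q_neq0 /=; rewrite /serre_ops; congr [:: _; _; _; _; _].
all: move: (x i1) (x i2) (x i3) => x1 x2 x3.
all: have lB (g : {linear V -> V}) u w : g (u - w) = g u - g w by exact: linearB.
all: have lZ (g : {linear V -> V}) b u : g (b *: u) = b *: g u by exact: linearZ.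
all: rewrite ?(lB x1, lB x2, lB x3, lZ x1, lZ x2, lZ x3).
all: by lin F; field; rewrite ?q_neq0.
Qed.

(** * Serre elements of the free algebra as operators *)

Section SerreRelators.
Variables (R : realType) (q : R[i]) (V : lmodType R[i]).
Local Notation freeAlg := {malg R[i][{fmonom generator}]}.
Variable a : freeAlg -> {linear V -> V}.
Hypotheses (aM : forall x y v, a (x * y) v = a x (a y v))
  (aB : forall x y v, a (x - y) v = a x v - a y v)
  (aZ : forall c x v, a (c *: x) v = c *: a x v).

Lemma act_qbr c x y v : a (qbr c x y) v = a x (a y v) - c *: a y (a x v).
Proof. by rewrite /qbr aB aM aZ aM. Qed.

Lemma act_serre (q_neq0 : q != 0) (x : 'I_3 -> freeAlg) v :
  [seq a r v | r <- serre q x] = serre_ops q (fun i => a (x i)) v.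
Proof.
have map5 r1 r2 r3 r4 r5 : [seq a r v | r <- [:: r1; r2; r3; r4; r5]] =
  [:: a r1 v; a r2 v; a r3 v; a r4 v; a r5 v] by [].
rewrite /serre map5 -serre_commutators //; congr [:: _; _; _; _; _].
- exact: act_qbr.
- by rewrite 3!act_qbr.
- by rewrite 3!act_qbr.
- have := act_qbr (q ^+ 2) (x i2) (x i3); move: (qbr (q ^+ 2) _ _) => z az.
  have := act_qbr 1 (x i2) z; move: (qbr 1 _ _) => y ay.
  by rewrite act_qbr !ay !az.
- by rewrite 3!act_qbr.
Qed.

Lemma act_serre0 (q_neq0 : q != 0) (x : 'I_3 -> freeAlg) (X : 'I_3 -> {linear V -> V}) v :
  (forall i, a (x i) =1 X i) -> serre_ops q X v = nseq 5 0 ->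
  forall r, r \in serre q x -> a r v = 0.
Proof.
move=> aX ops0 r s_r; have := act_serre q_neq0 x v.
have -> : (fun i => a (x i) : V -> V) = X by apply/funext => i; apply/funext => u; apply: aX.
rewrite ops0 => eq_r; have := map_f (fun y => a y v) s_r.
rewrite eq_r.
by rewrite mem_nseq => /andP[_ /eqP].
Qed.

End SerreRelators.

(** * Submodules generated by a highest vector *)

Section Span.
Variables (K : fieldType) (q : K) (V : lmodType K) (A : pre_action q V).
Variables (hv : V) (a : 'I_3 -> K).
Hypotheses (a_neq0 : forall i, a i != 0).
Hypotheses (e_hv : forall i, opE A i hv = 0) (k_hv : forall i, opK A i hv = a i *: hv).
Hypothesis q_neq0 : q != 0.

(** Only the f's are built in; [fspanK], [fspanKV] and [fspanE] show stability under the other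
    generators. *)
Inductive fspan : V -> Prop :=
| fspan_hv : fspan hv
| fspan0 : fspan 0
| fspanD u v : fspan u -> fspan v -> fspan (u + v)
| fspanZ c v : fspan v -> fspan (c *: v)
| fspanF i v : fspan v -> fspan (opF A i v).

Lemma fspanK i v : fspan v -> fspan (opK A i v).
Proof.
elim=> {v} [||u v _ Iu _ Iv|c v _ Iv|j v _ Iv].
- by rewrite k_hv; apply/fspanZ/fspan_hv.
- by rewrite linear0; apply: fspan0.
- by rewrite linearD; apply: fspanD.
- by rewrite linearZ; apply: fspanZ.
- by rewrite opKF; apply/fspanZ/fspanF.
Qed.

Lemma fspanKV i v : fspan v -> fspan (opKV A i v).
Proof.
elim=> {v} [||u v _ Iu _ Iv|c v _ Iv|j v _ Iv].
- rewrite -[hv]scale1r -(mulVf (a_neq0 i)) -scalerA -k_hv linearZ /= opKVK.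
  exact/fspanZ/fspan_hv.
- by rewrite linear0; apply: fspan0.
- by rewrite linearD; apply: fspanD.
- by rewrite linearZ; apply: fspanZ.
- by rewrite opKVF //; apply/fspanZ/fspanF.
Qed.

Lemma fspanE i v : fspan v -> fspan (opE A i v).
Proof.
elim=> {v} [||u v _ Iu _ Iv|c v _ Iv|j v fv Iv].
- by rewrite e_hv; apply: fspan0.
- by rewrite linear0; apply: fspan0.
- by rewrite linearD; apply: fspanD.
- by rewrite linearZ; apply: fspanZ.
- rewrite opEF; apply: fspanD; first exact: fspanF.
  do 2!apply: fspanZ; apply: fspanD; first exact: fspanK.
  by rewrite -scaleN1r; apply/fspanZ/fspanKV.
Qed.

Lemma serre_opsP (x : 'I_3 -> {linear V -> V}) c u v :
  serre_ops q x (c *: u + v) =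
  [seq c *: p.1 + p.2 | p <- zip (serre_ops q x u) (serre_ops q x v)].
Proof.
have lP (g : {linear V -> V}) b y z : g (b *: y + z) = b *: g y + g z by exact: linearP.
rewrite /serre_ops /=; congr [:: _; _; _; _; _];
  by rewrite !(lP (x i1), lP (x i2), lP (x i3)); lin K; ring.
Qed.

Lemma serre_ops0 (x : 'I_3 -> {linear V -> V}) : serre_ops q x 0 = nseq 5 0.
Proof.
have := serre_opsP x (-1) 0 0; rewrite scaler0 addr0 => ->.
by rewrite /= !scaleN1r !addNr.
Qed.

Lemma serre_fspan (q_nroot : forall n, (0 < n)%N -> q ^+ n != 1) v :
  fspan v -> serre_ops q (opE A) v = nseq 5 0.
Proof.
elim=> {v} [||u v _ Iu _ Iv|c v _ Iv|j v fv Iv].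
- have e0 i : opE A i 0 = 0 by exact: linear0.
  rewrite -[RHS](serre_ops0 (opE A)) /serre_ops.
  by rewrite !e_hv !e0.
- exact: serre_ops0.
- by rewrite -[u]scale1r serre_opsP Iu Iv /= !scaler0 !addr0.
- by rewrite -[_ *: _]addr0 serre_opsP Iv serre_ops0 /= !scaler0 !addr0.
- have f0 i : opF A i 0 = 0 by exact: linear0.
  by rewrite serre_opE_opF // Iv /= !f0.
Qed.

(** e1 commutes with f2 and f3. For e3 the two contributions cancel by the weights alone; for e2 the
    condition on [a i2] is what makes them cancel. *)
Lemma opE_fdelta i : (forall n, (0 < n)%N -> q ^+ n != 1) ->
  opF A i3 hv = 0 -> a i3 = 1 -> a i2 ^+ 2 = - q ^- 2 ->
  opE A i (fdelta q (opF A) hv) = 0.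
Proof.
move=> q_nroot f3_hv a3 a2.
have q21 : q * q - 1 != 0 by rewrite -expr2 subr_eq0 q_nroot.
have f0 j : opF A j 0 = 0 by exact: linear0.
have e0 j : opE A j 0 = 0 by exact: linear0.
have fZ j c v : opF A j (c *: v) = c *: opF A j v by exact: linearZ.
have eZ j c v : opE A j (c *: v) = c *: opE A j v by exact: linearZ.
have eD j u v : opE A j (u + v) = opE A j u + opE A j v by exact: linearD.
have eN j u : opE A j (- u) = - opE A j u by exact: linearN.
rewrite /fdelta f3_hv !f0 add0r eD eN eZ.
have [->|->|->] := ord3P i.
- by do ![rewrite opEF_neq //]; rewrite e_hv !f0 scaler0 oppr0 addr0.
- have k1 : opK A i2 (opF A i2 hv) = (q ^- 2 * a i2) *: opF A i2 hv.
    exact: (opKF_weight i2 (k_hv i2)).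
  have k2 : opK A i2 (opF A i3 (opF A i2 hv)) = a i2 *: opF A i3 (opF A i2 hv).
    by rewrite (opKF_weight i3 k1) qcartan mulVKf ?expf_neq0.
  rewrite (opEF_eq _ k2) // [opE A i2 (opF A i3 _)]opEF_neq // (opEF_eq _ (k_hv i2)) //.
  rewrite [opE A i2 (opF A i3 _)]opEF_neq // (opEF_eq _ k1) ?mulf_neq0 ?invr_neq0 ?expf_neq0 //.
  rewrite (opEF_eq _ (k_hv i2)) // e_hv !f0 !add0r.
  have fD u v : opF A i3 (u + v) = opF A i3 u + opF A i3 v by exact: linearD.
  rewrite !(fD, fZ) f3_hv f0 scaler0 add0r (invfM (q ^- 2)) (kappaV q_neq0 a2).
  by lin K; field; rewrite q_neq0 q21 ?oner_eq0.
- have k1 : opK A i3 (opF A i2 hv) = (q ^+ 2 * 1) *: opF A i2 hv.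
    by rewrite -a3; exact: (opKF_weight i2 (k_hv i3)).
  have k2 : opK A i3 (opF A i2 (opF A i2 hv)) = (q ^+ 2 * (q ^+ 2 * 1)) *: opF A i2 (opF A i2 hv).
    exact: (opKF_weight i2 k1).
  rewrite [opE A i3 (opF A i2 _)]opEF_neq // (opEF_eq _ k1) ?mulf_neq0 ?expf_neq0 ?oner_neq0 //.
  rewrite (opEF_eq _ k2) ?mulf_neq0 ?expf_neq0 ?oner_neq0 //.
  do ![rewrite [opE A i3 (opF A i2 _)]opEF_neq //]; rewrite e_hv !f0 !add0r fZ.
  by lin K; field; rewrite q_neq0 q21.
Qed.

End Span.

(** * The action on functions of words *)

Section Model.
Variables (F : fieldType) (q : F) (a : 'I_3 -> F).
Hypotheses (q_neq0 : q != 0) (a_neq0 : forall i, a i != 0).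

(* x [:: i_1; ...; i_n] is the coefficient of the highest vector in
   e_{i_n} ... e_{i_1} x. *)
Definition wordfun := seq 'I_3 -> F^o.
HB.instance Definition _ := GRing.Lmodule.on wordfun.

(** The scalar obtained by moving q^(h_i) to the left of the e's of the word and evaluating it at
    the highest weight. *)
Fixpoint kweight (i : 'I_3) (s : seq 'I_3) : F :=
  if s is j :: s' then q ^ (- cartan i j) * kweight i s' else a i.

Definition mE i (x : wordfun) : wordfun := fun s => x (i :: s).
Definition mK i (x : wordfun) : wordfun := fun s => kweight i s * x s.
Definition mKV i (x : wordfun) : wordfun := fun s => (kweight i s)^-1 * x s.

(** The relation for e_i f_j is read as a recursion on the word. The value at the empty word is 0,
    as f_j x has no component along the highest vector. *)
Fixpoint mF_rec (j : 'I_3) (s : seq 'I_3) (x : wordfun) : F :=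
  if s is i :: s' then mF_rec j s' (mE i x) +
    (i == j)%:R * ((q - q^-1)^-1 * (mK i x s' - mKV i x s'))
  else 0.
Definition mF j (x : wordfun) : wordfun := fun s => mF_rec j s x.

Fact mE_linear i : linear (mE i).
Proof. by []. Qed.
Fact mK_linear i : linear (mK i).
Proof.
move=> c x y; apply/funext => s.
by rewrite -[LHS]/(kweight i s * (c * x s + y s)) mulrDr mulrCA.
Qed.
Fact mKV_linear i : linear (mKV i).
Proof.
move=> c x y; apply/funext => s.
by rewrite -[LHS]/((kweight i s)^-1 * (c * x s + y s)) mulrDr mulrCA.
Qed.

Lemma mF_recP j s c x y : mF_rec j s (c *: x + y) = c * mF_rec j s x + mF_rec j s y.
Proof.
elim: s x y => [|i s IHs] x y /=; first by rewrite mulr0 addr0.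
rewrite mE_linear IHs mK_linear mKV_linear.
have eval (u v : wordfun) : (c *: u + v) s = c * u s + v s by [].
by rewrite !eval; ring.
Qed.

Lemma mF_recZ j s c x : mF_rec j s (c *: x) = c * mF_rec j s x.
Proof.
have F0 : mF_rec j s 0 = 0.
  have := mF_recP j s (-1) 0 0; rewrite scaler0 addr0 => ->.
  by rewrite mulN1r addNr.
by rewrite -[_ *: _]addr0 mF_recP F0 addr0.
Qed.

Fact mF_linear j : linear (mF j).
Proof. by move=> c x y; apply/funext => s; apply: mF_recP. Qed.

HB.instance Definition _ i := GRing.isLinear.Build F wordfun wordfun _ (mE i) (mE_linear i).
HB.instance Definition _ i := GRing.isLinear.Build F wordfun wordfun _ (mK i) (mK_linear i).
HB.instance Definition _ i := GRing.isLinear.Build F wordfun wordfun _ (mKV i) (mKV_linear i).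
HB.instance Definition _ i := GRing.isLinear.Build F wordfun wordfun _ (mF i) (mF_linear i).

Lemma kweight_neq0 i s : kweight i s != 0.
Proof.
elim: s => [|j s IHs] /=; first exact: a_neq0.
by rewrite mulf_neq0 // expfz_eq0 negb_and q_neq0 orbT.
Qed.

Lemma mKE i j x : mK i (mE j x) = q ^ cartan i j *: mE j (mK i x).
Proof.
apply/funext => s; have -> : (q ^ cartan i j *: mE j (mK i x)) s =
  q ^ cartan i j * (q ^ (- cartan i j) * kweight i s * x (j :: s)) by [].
by rewrite !mulrA -expfzDr // subrr expr0z mul1r.
Qed.

Lemma mKF i j x : mK i (mF j x) = q ^ (- cartan i j) *: mF j (mK i x).
Proof.
apply/funext => s.
have -> : (q ^ (- cartan i j) *: mF j (mK i x)) s =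
  q ^ (- cartan i j) * mF_rec j s (mK i x) by [].
rewrite {1}/mK /mF; elim: s x => [|l s IHs] x /=; first by rewrite !mulr0.
have qc0 : q ^ cartan i l != 0 by rewrite expfz_eq0 negb_and q_neq0 orbT.
have -> : mE l (mK i x) = q ^ (- cartan i l) *: mK i (mE l x).
  by rewrite mKE scalerA -expfzDr // addNr expr0z scale1r.
rewrite mF_recZ mulrDr -[_ * _ * mF_rec _ _ _]mulrA IHs.
case: eqVneq => [->|_]; last by rewrite !mul0r !mulr0 !addr0; ring.
by rewrite /mK /mKV; ring.
Qed.

Definition model : pre_action q wordfun.
Proof.
refine (@PreAction F q wordfun mE mF mK mKV _ _ mKE mKF _).
- by move=> i x; apply/funext => s; rewrite /= /mK /mKV mulVKf ?kweight_neq0.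
- by move=> i x; apply/funext => s; rewrite /= /mK /mKV mulKf ?kweight_neq0.
- by move=> i j x; apply/funext => s.
Defined.

(** A nonempty word starts with some e_i. Hence f1, f3 and f_delta kill the vacuum as soon as the
    e's kill the results. *)
Lemma wordfun_eq0 (x : wordfun) : x [::] = 0 -> (forall i, mE i x = 0) -> x = 0.
Proof.
move=> x0 eq_x; apply/funext => -[|i s] //.
by rewrite -[LHS]/(mE i x s) eq_x.
Qed.

Hypothesis q_nroot : forall n, (0 < n)%N -> q ^+ n != 1.

Lemma model_serreF x : serre_ops q (opF model) x = nseq 5 0.
Proof.
have comm j y : serre_ops q (opF model) (mE j y) =
    [seq mE j z | z <- serre_ops q (opF model) y].
  exact: (@serre_opE_opF F q wordfun (dual_action model q_neq0)).
(* Induction on the word: at the empty word every term starts with some [mF] and is 0, and a first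
   letter is moved inside by [comm]. *)
have zero s r : forall y, nth 0 (serre_ops q (opF model) y) r s = 0.
  elim: s => [|j s IHs] y.
    case: r => [|[|[|[|[|r]]]]] /=; last by rewrite nth_nil.
    - by rewrite -[LHS]/(0 - 0 : F) subrr.
    - by rewrite -[LHS]/(0 - (q + q^-1) * 0 + 0 : F) mulr0 subrr addr0.
    - by rewrite -[LHS]/(0 - (q + q^-1) * 0 + 0 : F) mulr0 subrr addr0.
    - set c := 1 + (q ^+ 2 + q ^- 2).
      by rewrite -[LHS]/(0 - c * 0 + c * 0 - 0 : F) mulr0 !(subrr, addr0).
    - by rewrite -[LHS]/(0 - (q ^+ 2 + q ^- 2) * 0 + 0 : F) mulr0 subrr addr0.
  rewrite -[LHS]/(mE j (nth 0 (serre_ops q (opF model) y) r) s).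
  have [lt_r|ge_r] := ltnP r 5; last by rewrite nth_default // linear0.
  by rewrite -(nth_map _ 0) // -comm IHs.
apply: (@eq_from_nth _ 0) => // r _; rewrite nth_nseq if_same.
by apply/funext => s; apply: zero.
Qed.

Definition vacuum : wordfun := fun s => (s == [::])%:R.

Lemma vacuum_neq0 : vacuum != 0.
Proof.
apply/eqP => /(congr1 (fun x : wordfun => x [::])); rewrite /vacuum eqxx.
by apply/eqP/oner_neq0.
Qed.

Lemma mE_vacuum i : mE i vacuum = 0.
Proof. exact/funext. Qed.

Lemma mK_vacuum i : mK i vacuum = a i *: vacuum.
Proof.
by apply/funext => -[|j s]; rewrite -[RHS]/(a i * vacuum _) /mK //= /vacuum /= !mulr0.
Qed.

Lemma mF_vacuum j : a j = 1 -> mF j vacuum = 0.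
Proof.
move=> aj; apply: wordfun_eq0 => // i.
rewrite -[mE i _]/(opE model i (opF model j vacuum)).
have := mK_vacuum j; rewrite -[mK j _]/(opK model j vacuum) aj => kv.
have [->|ij] := eqVneq i j; last by rewrite opEF_neq // [opE _ _ _]mE_vacuum linear0.
rewrite (opEF_eq _ kv) ?oner_neq0 // [opE _ _ _]mE_vacuum linear0.
by rewrite invr1 subrr mul0r scale0r addr0.
Qed.

Lemma fdelta_vacuum : a i3 = 1 -> a i2 ^+ 2 = - q ^- 2 -> fdelta q (opF model) vacuum = 0.
Proof.
move=> a3 a2; apply: wordfun_eq0 => [|i].
  by rewrite -[LHS]/(0 - (q ^+ 2 + q ^- 2) * 0 + 0 : F) mulr0 subrr addr0.
exact: (@opE_fdelta _ _ _ model vacuum a a_neq0 mE_vacuum mK_vacuum q_neq0 i q_nroot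
  (mF_vacuum a3) a3 a2).
Qed.

End Model.

Lemma root_formE i j : root_form i j = cartan i j.
Proof.
rewrite /root_form /bform !big_ord_recl big_ord0.
by case: (ord3P i) => ->; case: (ord3P j) => ->;
  rewrite /alpha /= !mxE /= ?mxE.
Qed.

(** * From relators to actions *)

Section ActionOfRelators.
Variables (R : realType) (q : R[i]) (V : lmodType R[i]).
Local Notation freeAlg := {malg R[i][{fmonom generator}]}.
Variable a : freeAlg -> {linear V -> V}.
Hypotheses (aM : forall x y v, a (x * y) v = a x (a y v))
  (aB : forall x y v, a (x - y) v = a x v - a y v)
  (aZ : forall c x v, a (c *: x) v = c *: a x v)
  (a1 : forall v, a 1 v = v).
Hypothesis q_neq0 : q != 0.

Local Notation e i := (gen R (GenE i)).
Local Notation f i := (gen R (GenF i)).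
Local Notation qh i := (gen R (GenK false i)).
Local Notation qhV i := (gen R (GenK true i)).

Lemma act_mul_sub1 x y v : a (x * y - 1) v = a x (a y v) - v.
Proof. by rewrite aB a1 aM. Qed.

Lemma act_eF x y z u b d v : a (qbr 1 x y - b *: (d *: (z - u))) v =
  a x (a y v) - a y (a x v) - b *: (d *: (a z v - a u v)).
Proof. by rewrite aB act_qbr // aZ aZ aB scale1r. Qed.

Section Kills.
Hypothesis a_rel : forall x v, Uq_relator q x -> a x v = 0.

Lemma rel_opKK i v : a (qh i) (a (qhV i) v) = v.
Proof.
have := a_rel v (Rel_qhV q false i); rewrite [LHS]act_mul_sub1 => /eqP.
by rewrite subr_eq0 => /eqP.
Qed.

Lemma rel_opKVK i v : a (qhV i) (a (qh i) v) = v.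
Proof.
have := a_rel v (Rel_qhV q true i); rewrite [LHS]act_mul_sub1 => /eqP.
by rewrite subr_eq0 => /eqP.
Qed.

Lemma rel_opKE i j v : a (qh i) (a (e j) v) = q ^ cartan i j *: a (e j) (a (qh i) v).
Proof.
have := a_rel v (Rel_qh_e q i j); rewrite [LHS](act_qbr aM aB aZ) root_formE => /eqP.
by rewrite subr_eq0 => /eqP.
Qed.

Lemma rel_opKF i j v : a (qh i) (a (f j) v) = q ^ (- cartan i j) *: a (f j) (a (qh i) v).
Proof.
have := a_rel v (Rel_qh_f q i j); rewrite [LHS](act_qbr aM aB aZ) root_formE => /eqP.
by rewrite subr_eq0 => /eqP.
Qed.

Lemma rel_opEF i j v : a (e i) (a (f j) v) = a (f j) (a (e i) v) +
  (i == j)%:R *: ((q - q^-1)^-1 *: (a (qh i) v - a (qhV i) v)).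
Proof.
have := a_rel v (Rel_e_f q i j); rewrite [LHS]act_eF => /eqP.
by rewrite subr_eq0 subr_eq addrC => /eqP.
Qed.

Definition relator_action : pre_action q V :=
  PreAction rel_opKK rel_opKVK rel_opKE rel_opKF rel_opEF.

Lemma relator_serreF v : serre_ops q (opF relator_action) v = nseq 5 0.
Proof.
rewrite -(act_serre aM aB aZ q_neq0 (fun i => f i) v).
have /eq_in_map -> : {in serre q (fun i => f i), a^~ v =1 fun=> 0}.
  by move=> r /(Rel_serre_f (q := q)) rel_r; apply: a_rel.
by [].
Qed.

End Kills.
End ActionOfRelators.

(** * Relators and stable predicates for an action of the free algebra *)

Section FreeActionClosure.
Variables (R : realType) (V : lmodType R[i]).
Local Notation freeAlg := {malg R[i][{fmonom generator}]}.
Variable a : freeAlg -> {linear V -> V}.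
Hypotheses (aM : forall x y v, a (x * y) v = a x (a y v))
  (aB : forall x y v, a (x - y) v = a x v - a y v)
  (aZ : forall c x v, a (c *: x) v = c *: a x v)
  (a1 : forall v, a 1 v = v).

Lemma act0 v : a 0 v = 0.
Proof. by rewrite -[0](subrr 0) aB subrr. Qed.

Lemma actDD x y v : a (x + y) v = a x v + a y v.
Proof.
have aN : a (- y) v = - a y v by rewrite -[- y]sub0r aB act0 sub0r.
by rewrite -[y in LHS]opprK aB aN opprK.
Qed.

Lemma act_commutator x y v : a (x * y - y * x) v = a x (a y v) - a y (a x v).
Proof.
by rewrite aB; congr (_ - _); exact: aM.
Qed.

Lemma act_commutator0 x y (X Y : V -> V) v : a x =1 X -> a y =1 Y ->
  X (Y v) = Y (X v) -> a (x * y - y * x) v = 0.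
Proof. by move=> aX aY XY; rewrite act_commutator !aX !aY XY subrr. Qed.

Lemma act_qbr0 c x y (X Y : V -> V) v : a x =1 X -> a y =1 Y ->
  X (Y v) = c *: Y (X v) -> a (qbr c x y) v = 0.
Proof. by move=> aX aY XY; rewrite act_qbr // !aX !aY XY subrr. Qed.

Lemma act_inverse0 x y (X Y : V -> V) v : a x =1 X -> a y =1 Y ->
  X (Y v) = v -> a (x * y - 1) v = 0.
Proof. by move=> aX aY XY; rewrite act_mul_sub1 // aX aY XY subrr. Qed.

Lemma act_eF0 x y z u b d (X Y Z U : V -> V) v :
  a x =1 X -> a y =1 Y -> a z =1 Z -> a u =1 U ->
  X (Y v) = Y (X v) + b *: (d *: (Z v - U v)) ->
  a (qbr 1 x y - b *: (d *: (z - u))) v = 0.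
Proof.
move=> aX aY aZ' aU XY; rewrite act_eF // !aX !aY aZ' aU XY.
by rewrite [_ + b *: _]addrC addrK subrr.
Qed.

Lemma act_fdelta q (x : 'I_3 -> freeAlg) v :
  a (x i2 ^+ 2 * x i3 - (q ^+ 2 + q ^- 2) *: (x i2 * x i3 * x i2) + x i3 * x i2 ^+ 2) v
  = fdelta q (fun i => a (x i)) v.
Proof.
rewrite /fdelta; move: (x i2) (x i3) => y z.
rewrite actDD aB aZ expr2; congr (_ - _ *: _ + _).
- exact: etrans (aM _ _ _) (aM _ _ _).
- exact: etrans (aM _ _ _) (aM _ _ _).
- exact: etrans (aM _ _ _) (congr1 (a z) (aM _ _ _)).
Qed.

Lemma malgU_scale c (m : {fmonom generator}) : mkmalgU m c = c *: (mkmalgU m 1 : freeAlg).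
Proof.
by apply/malgP => k; rewrite mcoeffZ !mcoeffU mulr_natr.
Qed.

Lemma malgU_cons g s : (mkmalgU (FMonom (g :: s)) 1 : freeAlg) = gen R g * mkmalgU (FMonom s) 1.
Proof.
rewrite malgM_def /gen fgmulUU mulr1; congr mkmalgU.
by rewrite /mmul /= fmmulE fmuE.
Qed.

Lemma act_closed (P : V -> Prop) : P 0 -> (forall u v, P u -> P v -> P (u + v)) ->
  (forall c v, P v -> P (c *: v)) -> (forall g v, P v -> P (a (gen R g) v)) ->
  forall x v, P v -> P (a x v).
Proof.
move=> P0 PD PZ Pg x v Pv; rewrite [x]monalgE.
elim: (enum_fset (msupp x)) => [|m ms IHms]; first by rewrite big_nil act0.
rewrite big_cons actDD; apply: PD => //; rewrite malgU_scale aZ; apply: PZ.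
case: m => s; elim: s => [|g s IHs]; last by rewrite malgU_cons aM; apply: Pg.
have -> : (mkmalgU (FMonom [::]) 1 : freeAlg) = 1 by congr mkmalgU; rewrite -fmoneE.
by rewrite a1.
Qed.

End FreeActionClosure.

(** * Maps that factor through a quotient module *)

Section QuotientFactor.
Variables (A : pzRingType) (V : lmodType A) (S : set V) (T : zmodType) (L : V -> T).
Hypotheses (LB : forall u v, L (u - v) = L u - L v)
  (LZ : forall c v, L v = 0 -> L (c *: v) = 0) (LS : forall v, S v -> L v = 0).

Lemma factor0 : L 0 = 0.
Proof. by rewrite -[0](subrr 0) LB subrr. Qed.

Lemma factorD u v : L (u + v) = L u + L v.
Proof.
have LN : L (- v) = - L v by rewrite -[- v]sub0r LB factor0 sub0r.
by rewrite -[v in LHS]opprK LB LN opprK.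
Qed.

(** The target is only an additive group; [LB] and [LZ] say that the kernel is a submodule, and it
    contains [S]. *)
Lemma lmod_span_ker v : v \in lmod_span S -> L v = 0.
Proof.
have kerL : submod_closed (fun u : V => L u == 0).
  split=> [|c x y]; first by rewrite unfold_in factor0.
  by rewrite !unfold_in factorD => /eqP Lx /eqP ->; rewrite LZ // addr0.
pose W : submodClosed V :=
  HB.pack (fun u : V => L u == 0) (GRing.isSubmodClosed.Build A V _ kerL).
move=> /asboolP /(_ W) L0; apply/eqP; apply: L0 => u /LS Lu.
by rewrite /mkset unfold_in; apply/eqP.
Qed.

Definition factor (v : lmodQuot S) : T := L (repr v).

Lemma factor_pi v : factor (\pi_(lmodQuot S) v) = L v.
Proof.
apply/eqP; rewrite -subr_eq0 -LB; apply/eqP/lmod_span_ker.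
by rewrite -lmodQuot_eq reprK.
Qed.

Lemma factorB u v : factor (u - v) = factor u - factor v.
Proof.
rewrite -[u in LHS]reprK -[v in LHS]reprK -raddfB factor_pi LB.
by [].
Qed.

Lemma factorZ c v : factor v = 0 -> factor (c *: v) = 0.
Proof.
by rewrite -{2}[v]reprK -pi_lmodQuotZ factor_pi; apply: LZ.
Qed.

End QuotientFactor.

(** * Evaluation of the quantum group at the vacuum *)

Section HighestWeightFunctional.
Variables (R : realType) (q : R[i]) (V : lmodType R[i]) (A : pre_action q V).
Variables (vac : V) (a : 'I_3 -> R[i]).
Hypotheses (q_neq0 : q != 0) (q_nroot : forall n, (0 < n)%N -> q ^+ n != 1).
Hypotheses (a_neq0 : forall i, a i != 0).
Hypothesis serreF : forall v, serre_ops q (opF A) v = nseq 5 0.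
Hypotheses (opE_vacuum : forall i, opE A i vac = 0)
  (opK_vacuum : forall i, opK A i vac = a i *: vac).
Hypothesis opKC : forall i j v, opK A i (opK A j v) = opK A j (opK A i v).
Local Notation freeAlg := {malg R[i][{fmonom generator}]}.

Definition genop (g : generator) : {linear V -> V} :=
  match g with
  | GenE i => opE A i | GenF i => opF A i
  | GenK false i => opK A i | GenK true i => opKV A i
  end.

Definition model_act (x : freeAlg) : {linear V -> V} := wact genop x.
Local Notation m := model_act.

Lemma model_actM x y v : m (x * y) v = m x (m y v). Proof. exact: wactM. Qed.
Lemma model_actB x y v : m (x - y) v = m x v - m y v. Proof. exact: wactB. Qed.
Lemma model_actZ c x v : m (c *: x) v = c *: m x v. Proof. exact: wactZ. Qed.
Lemma model_act1 v : m 1 v = v. Proof. exact: wact1. Qed.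

Lemma model_act_gen g v : m (gen R g) v = genop g v.
Proof. exact: wact_gen. Qed.

Lemma model_act_fspan x : fspan A vac (m x vac).
Proof.
have kv := opK_vacuum.
apply: (act_closed model_actM model_actB model_actZ model_act1
  (P := fspan A vac)); [exact: fspan0 | exact: fspanD | exact: fspanZ | | exact: fspan_hv].
move=> g v fv; rewrite model_act_gen; case: g => [i|i|[] i] /=.
- exact: (fspanE a_neq0 opE_vacuum kv q_neq0).
- exact: fspanF.
- exact: (fspanKV a_neq0 kv q_neq0).
- exact: (fspanK kv).
Qed.

(** The vanishing is stated on the vectors generated by [vac], because that is where [serre_fspan]
    controls the e-Serre elements. *)
Lemma model_act_relator x : Uq_relator q x -> forall y, m x (m y vac) = 0.
Proof.
move=> + y; case=> [b i b' j|b i|i j|i j|i j|r s_r|r s_r].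
- apply: (act_commutator0 model_actM model_actB
    (model_act_gen (GenK b i)) (model_act_gen (GenK b' j))).
  have KKV k l v : opK A k (opKV A l v) = opKV A l (opK A k v).
    by rewrite -[in RHS](opKK A l v) opKC opKVK.
  case: b b' => -[] //=.
  by rewrite -[opKV A i (opKV A j _)](opKVK A j) KKV opKK.
- apply: (act_inverse0 model_actM model_actB model_act1
    (model_act_gen (GenK b i)) (model_act_gen (GenK (~~ b) i))).
  by case: b => /=; [exact: (opKVK A) | exact: (opKK A)].
- apply: (act_qbr0 model_actM model_actB model_actZ
    (model_act_gen (GenK false i)) (model_act_gen (GenE j))).
  by rewrite root_formE; exact: (opKE A).
- apply: (act_qbr0 model_actM model_actB model_actZ
    (model_act_gen (GenK false i)) (model_act_gen (GenF j))).
  by rewrite root_formE; exact: (opKF A).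
- apply: (act_eF0 model_actM model_actB model_actZ
    (model_act_gen (GenE i)) (model_act_gen (GenF j))
    (model_act_gen (GenK false i)) (model_act_gen (GenK true i))).
  exact: (opEF A).
- apply: (act_serre0 model_actM model_actB model_actZ q_neq0
    (fun i => model_act_gen (GenE i)) _ s_r).
  exact: (serre_fspan opE_vacuum q_neq0 q_nroot (model_act_fspan y)).
- apply: (act_serre0 model_actM model_actB model_actZ q_neq0
    (fun i => model_act_gen (GenF i)) _ s_r).
  exact: serreF.
Qed.

Definition Uq_vacuum (u : Uq q) : V := m (repr (u : ringQuot (Uq_relator q))) vac.

Lemma Uq_vacuumE x : Uq_vacuum (Uq_of q x) = m x vac.
Proof.
(* The annihilator of all vectors generated by [vac]. Quantifying over [y] absorbs right factors and
   makes it a two-sided ideal. *)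
pose J := fun x : freeAlg => forall y, m x (m y vac) = 0.
have J_ideal : two_sided_ideal J.
  split=> [y|x1 x2 Jx1 Jx2 y|b c x1 Jx1 y]; first exact: act0 model_actB _.
    by rewrite model_actB Jx1 Jx2 subrr.
  have -> : m (b * x1 * c) (m y vac) = m b (m x1 (m (c * y) vac)).
    rewrite [RHS](congr1 (fun z => m b (m x1 z)) (model_actM c y vac)).
    exact: etrans (model_actM _ _ _) (model_actM _ _ _).
  by rewrite Jx1; apply: linear0.
set z := repr (Uq_of q x : ringQuot (Uq_relator q)).
have /asboolP/(_ J J_ideal)/(_ model_act_relator) : z - x \in ideal_gen (Uq_relator q).
  by rewrite -ringQuot_eq reprK.
move=> /(_ 1); rewrite model_act1 model_actB => /eqP; rewrite subr_eq0 => /eqP eq_z.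
exact: eq_z.
Qed.

End HighestWeightFunctional.

Section LmodQuotZero.
Variables (A : pzRingType) (V : lmodType A) (S : set V).
Lemma pi_lmodQuot_eq0 v : S v -> \pi_(lmodQuot S) v = 0.
Proof.
move=> Sv; apply/eqP; rewrite -[0](raddf0 (\pi_(lmodQuot S))) lmodQuot_eq subr0.
by apply/asboolP => W; apply.
Qed.
Lemma pi_lmodQuot0 : \pi_(lmodQuot S) (0 : V) = 0.
Proof. exact: raddf0. Qed.
End LmodQuotZero.

(** * The highest vector of the base module is nonzero *)

Section BaseNonzero.
Variables (R : realType) (q : R[i]) (V : lmodType R[i]) (A : pre_action q V).
Variables (vac : V) (a : 'I_3 -> R[i]).
Hypotheses (q_neq0 : q != 0) (q_nroot : forall n, (0 < n)%N -> q ^+ n != 1).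
Hypotheses (a_neq0 : forall i, a i != 0).
Hypothesis serreF : forall v, serre_ops q (opF A) v = nseq 5 0.
Hypotheses (opE_vacuum : forall i, opE A i vac = 0)
  (opK_vacuum : forall i, opK A i vac = a i *: vac).
Hypothesis opKC : forall i j v, opK A i (opK A j v) = opK A j (opK A i v).
Hypotheses (f1_vacuum : opF A i1 vac = 0) (f3_vacuum : opF A i3 vac = 0)
  (fdelta_vacuum : fdelta q (opF A) vac = 0) (vac_neq0 : vac != 0).
Variables (hbar : R[i]) (lambda : 'rV[R[i]]_3).
Hypothesis weight : forall i, a i = qpow hbar (bform (alpha _ i) lambda).

Local Notation L := (@Uq_vacuum R q V A vac).
Local Notation m := (@model_act R q V A).

Lemma Uq_vacuum_of x : L (Uq_of q x) = m x vac.
Proof. exact: (Uq_vacuumE q_neq0 q_nroot a_neq0 serreF opE_vacuum opK_vacuum opKC). Qed.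

Lemma Uq_ofP (u : Uq q) : exists x, u = Uq_of q x.
Proof. by exists (repr (u : ringQuot (Uq_relator q))); rewrite /Uq_of reprK. Qed.

Lemma Uq_vacuumB (u v : (Uq q)^o) : L (u - v) = L u - L v.
Proof.
have [x ->] := Uq_ofP u; have [y ->] := Uq_ofP v.
by rewrite -raddfB !Uq_vacuum_of model_actB.
Qed.

Lemma Uq_vacuum_ker (c u : (Uq q)^o) : L u = 0 -> L (c *: u) = 0.
Proof.
have [x ->] := Uq_ofP c; have [y ->] := Uq_ofP u.
rewrite Uq_vacuum_of -[_ *: _]/(Uq_of q x * Uq_of q y) -rmorphM Uq_vacuum_of model_actM => ->.
exact: linear0.
Qed.

Lemma Uq_vacuum_relator x : @Verma_relators R q hbar lambda x -> L x = 0.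
Proof.
case=> i [->|->]; rewrite Uq_vacuum_of ?model_actB model_act_gen; first exact: opE_vacuum.
by rewrite model_actZ model_act1 [genop _ _ _]opK_vacuum weight subrr.
Qed.

Local Notation L1 := (@factor (Uq q) _ (@Verma_relators R q hbar lambda) V L).

Lemma Verma_vacuumE x : L1 (Uq_of q x *: @Verma_hv R q hbar lambda) = m x vac.
Proof.
rewrite /Verma_hv -pi_lmodQuotZ (factor_pi Uq_vacuumB Uq_vacuum_ker Uq_vacuum_relator) -Uq_vacuum_of.
by congr Uq_vacuum; exact: mulr1.
Qed.

Lemma Verma_vacuum_relator v : @base_relators R q hbar lambda v -> L1 v = 0.
Proof.
case=> x rel_x <-; rewrite Verma_vacuumE; case: rel_x => [[]|] ->.
- by rewrite model_act_gen.
- by rewrite model_act_gen.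
- rewrite /f_delta [LHS](act_fdelta (@model_actM _ _ _ A) (@model_actB _ _ _ A)
    (@model_actZ _ _ _ A) q (fun i => gen R (GenF i))).
  rewrite -[RHS]fdelta_vacuum; congr (fdelta q _ vac).
  by apply/funext => i; apply/funext => v'; apply: model_act_gen.
Qed.

Definition base_hv : @base_module R q hbar lambda :=
  \pi_(lmodQuot (@base_relators R q hbar lambda)) (@Verma_hv R q hbar lambda).

(** Evaluation at [vac] descends to the Verma module and then to the base module, where it sends
    [base_hv] to [vac]. *)
Lemma base_hv_neq0 : base_hv != 0.
Proof.
apply/eqP => hv0; case/eqP: vac_neq0.
have L1B := factorB Uq_vacuumB Uq_vacuum_ker Uq_vacuum_relator.
have L1Z := factorZ Uq_vacuumB Uq_vacuum_ker Uq_vacuum_relator.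
have <- : factor L1 base_hv = vac.
  rewrite (factor_pi L1B L1Z Verma_vacuum_relator).
  have -> : Verma_hv q hbar lambda = Uq_of q 1 *: Verma_hv q hbar lambda.
    by rewrite [Uq_of q 1](rmorph1 (Uq_of q)) scale1r.
  by rewrite Verma_vacuumE model_act1.
by rewrite hv0; apply: factor0 (factorB L1B L1Z Verma_vacuum_relator).
Qed.

End BaseNonzero.

(** * Irreducibility *)

Section Irreducibility.
Variables (R : realType) (q : R[i]) (V : lmodType R[i]) (hv : V) (a : 'I_3 -> R[i]).
Variable m : {malg R[i][{fmonom generator}]} -> {linear V -> V}.
Hypotheses (mM : forall x y v, m (x * y) v = m x (m y v))
  (mB : forall x y v, m (x - y) v = m x v - m y v)
  (mZ : forall c x v, m (c *: x) v = c *: m x v)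
  (m1 : forall v, m 1 v = v).
Hypothesis m_rel : forall x v, Uq_relator q x -> m x v = 0.
Hypotheses (q_neq0 : q != 0) (q_nroot : forall n, (0 < n)%N -> q ^+ n != 1).
Hypotheses (a_1 : a i1 = 1) (a_3 : a i3 = 1) (a_2 : a i2 ^+ 2 = - q ^- 2).

Hypotheses (e_hv : forall i, m (gen R (GenE i)) hv = 0)
  (k_hv : forall i, m (gen R (GenK false i) - (a i)%:A) hv = 0)
  (f1_hv : m (gen R (GenF i1)) hv = 0) (f3_hv : m (gen R (GenF i3)) hv = 0)
  (fd_hv : m (f_delta q) hv = 0).
Hypothesis hv_cyclic : forall v, exists x, v = m x hv.

Local Notation A := (relator_action mM mB mZ m1 m_rel).

Lemma base_opK i : opK A i hv = a i *: hv.
Proof.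
have := k_hv i; rewrite mB [X in _ - X]mZ [X in _ - _ *: X]m1.
by move/eqP; rewrite subr_eq0 => /eqP.
Qed.

Lemma a_neq0 i : a i != 0.
Proof.
have a2_neq0 : a i2 != 0.
  have : a i2 ^+ 2 != 0 by rewrite a_2 oppr_eq0 invr_eq0 expf_neq0.
  by rewrite expf_eq0.
have [->|->|->] := ord3P i.
all: by rewrite ?a_1 ?a_3 ?oner_neq0.
Qed.

Lemma base_serreF v : serre_ops q (opF A) v = nseq 5 0.
Proof. exact (relator_serreF mM mB mZ m1 q_neq0 m_rel v). Qed.

Lemma base_good : good A hv.
Proof.
split; [exact: f1_hv | exact: f3_hv | | exact: e_hv | exact: e_hv | | ].
- rewrite -[RHS]fd_hv /f_delta.
  exact: esym (act_fdelta mM mB mZ q (fun i => gen R (GenF i)) _).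
- by rewrite base_opK a_1 scale1r.
- by rewrite base_opK a_3 scale1r.
Qed.

Lemma two_neq0 : 2 != 0 :> R[i].
Proof. by rewrite pnatr_eq0. Qed.

(** Cyclicity first reduces v to words in the f's applied to hv; these stay in the span of the
    vectors [vec]. *)
Lemma base_inspan v : inspan A hv v.
Proof.
have fspanN : fspan A hv v.
  have [x ->] := hv_cyclic v.
  apply: (act_closed mM mB mZ m1 (P := fspan A hv));
    [exact: fspan0 | exact: fspanD | exact: fspanZ | | exact: fspan_hv].
  move=> g u fu; case: g => [i|i|[] i].
  - exact: (fspanE (A := A) a_neq0 e_hv base_opK q_neq0).
  - exact: (fspanF (A := A)).
  - exact: (fspanKV (A := A) a_neq0 base_opK q_neq0).
  - exact: (fspanK (A := A) base_opK).
have serreF := base_serreF; have good_hv := base_good.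
elim: fspanN => {v} [||u v _ Iu _ Iv|c v _ Iv|i v _ Iv].
- by apply: (@inspan_vec _ _ _ A hv (0, 0, 0, 0)).
- exact: inspan0.
- exact: inspanD.
- exact: inspanZ.
- have [->|->|->] := ord3P i.
  + exact: (inspan_f1 q_neq0 q_nroot two_neq0 serreF good_hv).
  + exact: (inspan_f2 q_neq0 q_nroot two_neq0 serreF good_hv).
  + exact: (inspan_f3 q_neq0 q_nroot two_neq0 serreF good_hv).
Qed.

Theorem cyclic_lead (W : V -> Prop) v : (forall c u, W u -> W (c *: u)) ->
  (forall x u, W u -> W (m x u)) -> v != 0 -> W v -> W hv.
Proof.
move=> WZ Wm v_neq0 Wv.
have WE i u : W u -> W (opE A i u) by exact: Wm.
exact: (inspan_lead q_neq0 q_nroot two_neq0 base_serreF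
  base_good (e_hv i2) (base_opK i2) a_2 WZ WE (base_inspan v) v_neq0 Wv).
Qed.

End Irreducibility.

(** * Complex powers of q *)

Section ComplexPowers.
Variable R : realType.

Lemma cexpD (x y : R[i]) : cexp (x + y) = cexp x * cexp y.
Proof.
case: x y => [xr xi] [yr yi]; rewrite /cexp /= expRD cosD sinD.
by apply/eqP; rewrite eq_complex /=; apply/andP; split; apply/eqP; ring.
Qed.

Lemma qpowD (hbar x y : R[i]) : qpow hbar (x + y) = qpow hbar x * qpow hbar y.
Proof. by rewrite /qpow mulrDr cexpD. Qed.

Lemma bformC (u v : 'rV[R[i]]_3) : bform u v = bform v u.
Proof. by apply: eq_bigr => i _; rewrite mulrC. Qed.

(** 2 alpha_2 + alpha_3 = 2 eps_2, so the condition at eps_2 fixes the square of the q^h2-weight of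
    the highest vector. *)
Lemma alpha2_double (lambda : 'rV[R[i]]_3) :
  bform (alpha _ i2) lambda + bform (alpha _ i2) lambda + bform lambda (alpha _ i3)
  = 2 * bform lambda (eps _ i2).
Proof.
rewrite /bform !big_ord_recl !big_ord0 /alpha /= !mxE /= ?mxE /=.
ring.
Qed.

End ComplexPowers.

Theorem cyclic_irreducible (R : realType) (q : R[i]) (M : lmodType (Uq q)) (hv : M)
  (a : 'I_3 -> R[i]) :
  q != 0 -> (forall n, (0 < n)%N -> q ^+ n != 1) ->
  a i1 = 1 -> a i3 = 1 -> a i2 ^+ 2 = - q ^- 2 ->
  (forall i, Uq_of q (gen R (GenE i)) *: hv = 0) ->
  (forall i, Uq_of q (gen R (GenK false i) - (a i)%:A) *: hv = 0) ->
  Uq_of q (gen R (GenF i1)) *: hv = 0 -> Uq_of q (gen R (GenF i3)) *: hv = 0 ->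
  Uq_of q (f_delta q) *: hv = 0 ->
  (forall v : M, exists x, v = Uq_of q x *: hv) -> hv != 0 -> irreducible_lmod M.
Proof.
move=> q_neq0 q_nroot a_1 a_3 a_2 e_hv k_hv f1_hv f3_hv fd_hv hv_cyclic hv_neq0.
split=> [|W]; first by exists hv.
have [W0|/existsNP[v /not_implyP[Wv /eqP v_neq0]]] :=
    pselect (forall v, v \in W -> v = 0); first by left.
(* By cyclicity it suffices that [W] contains hv. *)
right => u; have [x ->] := hv_cyclic u; apply: rpredZ.
pose N := restrict_scalars M (Uq_of q : {rmorphism _ -> Uq q}).
pose m x : {linear N -> N} := act x.
have m_rel y (z : N) : Uq_relator q y -> m y z = 0.
  by move=> /Uq_of_relator rel_x; apply: act_eq0.
apply: (@cyclic_lead R q N hv a m (@actM _ _ _ _ _) (@actB _ _ _ _ _) (@actZ _ _ _ _ _)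
  (@act1 _ _ _ _ _) m_rel q_neq0 q_nroot a_1 a_3 a_2 e_hv k_hv f1_hv f3_hv fd_hv
  hv_cyclic (fun y : N => (y : M) \in W) v) => //.
- by move=> c y Wy; apply: rpredZ.
- by move=> y z Wz; apply: rpredZ.
Qed.

(** * Relations and cyclicity of the highest vector *)

Section BaseModuleVector.
Variables (R : realType) (q hbar : R[i]) (lambda : 'rV[R[i]]_3).
Local Notation hv := (base_hv q hbar lambda).
Local Notation piV := (\pi_(lmodQuot (@Verma_relators R q hbar lambda))).
Local Notation piB := (\pi_(lmodQuot (@base_relators R q hbar lambda))).

Lemma scale_Verma_hv (u : Uq q) : u *: Verma_hv q hbar lambda = piV (u : (Uq q)^o).
Proof.
by rewrite /Verma_hv -pi_lmodQuotZ; congr piV; exact: mulr1.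
Qed.

Lemma scale_base_hv (u : Uq q) : u *: hv = piB (u *: Verma_hv q hbar lambda).
Proof. by rewrite /base_hv -pi_lmodQuotZ. Qed.

Lemma base_hv_Verma_relator (u : Uq q) :
  Verma_relators hbar lambda (u : (Uq q)^o) -> u *: hv = 0.
Proof.
by move=> rel_u; rewrite scale_base_hv scale_Verma_hv (pi_lmodQuot_eq0 rel_u) pi_lmodQuot0.
Qed.

Lemma base_hv_relator (x : {malg R[i][{fmonom generator}]}) :
  [set gen R (GenF i1); gen R (GenF i3); f_delta q]%classic x -> Uq_of q x *: hv = 0.
Proof.
by move=> rel_x; rewrite scale_base_hv pi_lmodQuot_eq0 //; exists x.
Qed.

Lemma base_hv_cyclic (v : base_module q hbar lambda) : exists x, v = Uq_of q x *: hv.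
Proof.
have [x eq_x] := Uq_ofP (repr (repr v : Verma q hbar lambda) : Uq q).
exists x; rewrite scale_base_hv scale_Verma_hv -eq_x.
by rewrite !reprK.
Qed.

End BaseModuleVector.

Theorem proposition2p7 (R : realType) (q hbar : R[i]) (lambda : 'rV[R[i]]_3)
  (q_neq0 : q != 0)
  (q_not_root_of_unity : forall n : nat, (0 < n)%N -> q ^+ n != 1)
  (hbar_log : cexp hbar = q)
  (lambda_alpha1 : qpow hbar (bform lambda (alpha _ i1)) = 1)
  (lambda_alpha3 : qpow hbar (bform lambda (alpha _ i3)) = 1)
  (lambda_eps1 : qpow hbar (2 * bform lambda (eps _ i1)) = - q ^- 2)
  (lambda_eps2 : qpow hbar (2 * bform lambda (eps _ i2)) = - q ^- 2) :
  irreducible_lmod (base_module q hbar lambda).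
Proof.
pose a i := qpow hbar (bform (alpha R[i] i) lambda).
have a_1 : a i1 = 1 by rewrite /a bformC.
have a_3 : a i3 = 1 by rewrite /a bformC.
have a_2 : a i2 ^+ 2 = - q ^- 2.
  rewrite -lambda_eps2 -alpha2_double !qpowD lambda_alpha3 mulr1.
  by rewrite expr2.
have a0 := a_neq0 q_neq0 a_1 a_3 a_2.
have hv_neq0 : base_hv q hbar lambda != 0.
  apply: (@base_hv_neq0 R q _ (model q_neq0 a0) (vacuum R[i]) a) => //.
  - exact: model_serreF.
  - exact: mK_vacuum.
  - by move=> i j v; apply/funext => s; rewrite /= /mK mulrCA.
  - exact: mF_vacuum.
  - exact: mF_vacuum.
  - exact: fdelta_vacuum.
  - exact: vacuum_neq0.
apply: (cyclic_irreducible (hv := base_hv q hbar lambda) (a := a)) => //.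
- by move=> i; apply: base_hv_Verma_relator; exists i; left.
- by move=> i; apply: base_hv_Verma_relator; exists i; right.
- by apply: base_hv_relator; left; left.
- by apply: base_hv_relator; left; right.
- by apply: base_hv_relator; right.
- exact: base_hv_cyclic.
Qed.
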